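(* Let $G$ be a locally compact group and let $H$ be a unimodular closed subgroup of $G$ such that the homogeneous space $H\backslash G$ has a finite relatively invariant measure $\nu$. Then the left regular representation $\lambda:\mathcal{H}(G,H)\to B(L^2(H\backslash G,\nu))$, $\lambda(f)(\xi)=f\ast\xi$, is a well defined $\ast$-homomorphism.
   Context: $H\backslash G$ is the space of right cosets $Hx$. A relatively invariant measure on $H\backslash G$ is a nonzero Radon measure $\nu$ for which there is a continuous homomorphism $\chi:G\to\mathbb{R}_{>0}$ with $\nu(Ex)=\chi(x)\nu(E)$ for all $x\in G$ and all Borel sets $E$; it is finite if $\nu(H\backslash G)<\infty$. Under the hypotheses of the claim it is known that $G$ is unimodular and that $\nu$ is right $G$-invariant. The measure $\nu$ is normalized, relative to right Haar measures $\mu$ on $G$ and $\eta$ on $H$, so that $\int_G f\,d\mu=\int_{H\backslash G}\int_H f(hy)\,d\eta(h)\,d\nu(Hy)$ for all $f\in C_c(G)$. The Hecke algebra is $\mathcal{H}(G,H)=\{f\in C_c(H\backslash G): f(Hxh)=f(Hx)\ \forall x\in G,h\in H\}$, where for $f\in\mathcal{H}(G,H)$ one writes $f(HxH)=f(x)=f(Hx)$. Its product is $(f\ast g)(Hx)=\int_{H\backslash G}f(Hxy^{-1}H)\,g(Hy)\,d\nu(Hy)$ and its involution is $f^{*}(Hx)=\Delta_G(x)\overline{f(Hx^{-1})}$, where $\Delta_G$ is the modular function of $G$. For $\xi\in L^2(H\backslash G,\nu)$, $f\ast\xi$ is defined by the same integral formula with $g$ replaced by $\xi$. ''Well defined'' means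 in particular that each $\lambda(f)$ is a bounded operator on $L^2(H\backslash G,\nu)$. *)

(* Defs.v *)
From HB Require Import structures.
From mathcomp Require Import all_boot all_order all_algebra.
From mathcomp Require Import complex ring.
From mathcomp Require Import all_classical all_reals all_analysis.
From mathcomp Require Import measurable_realfun.

Set Implicit Arguments.
Unset Strict Implicit.
Unset Printing Implicit Defensive.

Import Order.TTheory GRing.Theory Num.Theory.
Import numFieldNormedType.Exports.

Local Open Scope classical_set_scope.
Local Open Scope ring_scope.
Local Open Scope quotient_scope.

(* Complex-valued functions have codomain [R[i]^o], the alias of [R[i]] on which
   the library puts the topology of the modulus. *)

HB.mixin Record isTopologicalGroup G & PointedTopological G & Group G := {
  mulg_continuous : continuous (fun p : G * G => (p.1 * p.2)%g);
  invg_continuous : continuous (fun x : G => (x^-1)%g)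
}.

#[short(type="topGroupType")]
HB.structure Definition TopologicalGroup :=
  {G of PointedTopological G & Group G & isTopologicalGroup G}.

Section subgroup.
Variables (G : topGroupType) (H : groupClosed G).

Record subgroup := Subgroup { subgroup_val :> G; _ : subgroup_val \in H }.

HB.instance Definition _ := [isSub for subgroup_val].
HB.instance Definition _ := [Choice of subgroup by <:].
Lemma subgroup_closed : group_closed (fun x => x \in H).
Proof. split; [exact: gpred1 | by move=> x y; exact: gpredF]. Qed.
HB.instance Definition _ :=
  SubChoice_isSubGroup.Build G (fun x => x \in H) subgroup subgroup_closed.
HB.instance Definition _ := isPointed.Build subgroup 1%g.
HB.instance Definition _ :=
  Topological.copy subgroup (initial_topology (val : subgroup -> G)).

Lemma subgroup_val_continuous : continuous (val : subgroup -> G).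
Proof. exact: initial_continuous. Qed.

Lemma subgroup_mulg_continuous :
  continuous (fun p : subgroup * subgroup => (p.1 * p.2)%g).
Proof.
apply: (@continuous_comp_initial _ _ _ (val : subgroup -> G)) => p /=.
apply: (@continuous_comp _ _ _
  (fun p : subgroup * subgroup => (val p.1, val p.2))
  (fun q : G * G => (q.1 * q.2)%g)); last exact: mulg_continuous.
by apply: cvg_pair; (apply: continuous_comp; last exact: subgroup_val_continuous);
  [exact: cvg_fst | exact: cvg_snd].
Qed.

Lemma subgroup_invg_continuous : continuous (fun x : subgroup => (x^-1)%g).
Proof.
apply: (@continuous_comp_initial _ _ _ (val : subgroup -> G)) => x /=.
apply: (@continuous_comp _ _ _ (val : subgroup -> G) (fun y : G => (y^-1)%g)).
  exact: subgroup_val_continuous.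
exact: invg_continuous.
Qed.

HB.instance Definition _ := isTopologicalGroup.Build subgroup
  subgroup_mulg_continuous subgroup_invg_continuous.

End subgroup.

Section right_cosets.
Variables (G : topGroupType) (H : groupClosed G).

(* [x y^-1 \in H] iff [H x = H y]. *)
Definition rcoset_rel : rel G := fun x y => (x * y^-1)%g \in H.

Lemma rcoset_rel_equiv : equiv_class_of rcoset_rel.
Proof.
split=> [x|x y|y x z]; rewrite /rcoset_rel ?mulgV ?gpred1//.
  by rewrite -[RHS]gpredV invgM invgK.
move=> xy yz; have -> : (x * z^-1 = (x * y^-1) * (y * z^-1))%g.
  by rewrite -mulgA (mulgA y^-1%g) mulVg mul1g.
exact: gpredM.
Qed.

Canonical rcoset_equiv := EquivRelPack rcoset_rel_equiv.
Canonical rcoset_encModRel := defaultEncModRel rcoset_rel.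

Definition right_cosets : Type := quotient_topology {eq_quot rcoset_rel}.

HB.instance Definition _ := PointedTopological.on right_cosets.
HB.instance Definition _ := Quotient.on right_cosets.

Definition coset (x : G) : right_cosets := \pi_right_cosets x.

Lemma cosetP x y : reflect (coset x = coset y) ((x * y^-1)%g \in H).
Proof.
have e : (\pi_{eq_quot rcoset_rel} x == \pi_{eq_quot rcoset_rel} y) = rcoset_rel x y.
  exact: eqmodE.
by rewrite -[_ \in H]e; apply: (iffP eqP).
Qed.

Definition coset_act (X : right_cosets) (x : G) : right_cosets :=
  coset (repr X * x)%g.

Lemma coset_actE x y : coset_act (coset x) y = coset (x * y)%g.
Proof.
apply/cosetP; rewrite invgM -!mulgA mulVKg.
by apply/cosetP; rewrite /coset reprK.
Qed.

End right_cosets.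

Section measures.
Variable R : realType.
Implicit Types T : ptopologicalType.

Definition borel T : measurableType _ := g_sigma_algebraType (@open T).

(* Locally finite Borel measures, outer regular on Borel sets and inner regular
   on open sets; finite such measures are inner regular on all Borel sets. *)
Definition radon T (m : {measure set (borel T) -> \bar R}) :=
  [/\ forall K : set T, compact K -> (m K < +oo)%E,
      forall E : set (borel T), measurable E ->
        m E = ereal_inf [set m U | U in [set U : set T | open U /\ E `<=` U]]
    & forall U : set T, open U ->
        m U = ereal_sup [set m K | K in [set K : set T | compact K /\ K `<=` U]]].

Definition right_haar (G : topGroupType) (m : {measure set (borel G) -> \bar R}) :=
  [/\ radon m, m setT != 0%E
    & forall (x : G) (E : set (borel G)), measurable E ->
        m [set (y * x)%g | y in E] = m E].

(* For a left Haar measure [l] this is the convention [l (E x) = Delta x * l E],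
   transported to right Haar measures by [E |-> E^-1]; it makes
   [f |-> Delta x * conj (f x^-1)] isometric for the right Haar measure. *)
Definition modular_function (G : topGroupType) (Delta : G -> R) :=
  (forall x, 0 < Delta x) /\
  forall m : {measure set (borel G) -> \bar R}, right_haar m ->
  forall (x : G) (E : set (borel G)), measurable E ->
    m [set (x * y)%g | y in E] = ((Delta x)^-1%:E * m E)%E.

Definition unimodular (G : topGroupType) := modular_function (fun _ : G => 1).

Definition relatively_invariant (G : topGroupType) (H : groupClosed G)
    (nu : {measure set (borel (right_cosets H)) -> \bar R}) :=
  [/\ radon nu, nu setT != 0%E
    & exists chi : G -> R,
      [/\ continuous chi, forall x, 0 < chi x,
          forall x y, chi (x * y)%g = chi x * chi y
        & forall (x : G) (E : set (borel (right_cosets H))), measurable E ->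
            nu [set coset_act X x | X in E] = ((chi x)%:E * nu E)%E]].

End measures.

Section complex_integral.
Context d (T : measurableType d) (R : realType).
Variable m : {measure set T -> \bar R}.
Implicit Types f g : T -> R[i]^o.

Definition cmeasurable f :=
  measurable_fun setT (fun x => complex.Re (f x)) /\
  measurable_fun setT (fun x => complex.Im (f x)).

Definition cintegrable f :=
  m.-integrable setT (fun x => (complex.Re (f x))%:E) /\
  m.-integrable setT (fun x => (complex.Im (f x))%:E).

(* [Rintegral] is a total function: [cint f] is meaningful only if [cintegrable f]. *)
Definition cint f : R[i] :=
  ((\int[m]_x complex.Re (f x)) +i* (\int[m]_x complex.Im (f x)))%C.

Lemma eq_ae_cint f g : cmeasurable f -> cmeasurable g ->
  {ae m, forall x, f x = g x} -> cint f = cint g.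
Proof.
move=> [fr fi] [gr gi] fg; rewrite /cint; congr Complex; rewrite /Rintegral;
  congr fine; apply: ae_eq_integral => //; try exact/measurable_EFinP;
  by apply: filterS fg => x -> _.
Qed.

Lemma cmeasurableMJ f g : cmeasurable f -> cmeasurable g ->
  cmeasurable (fun x => f x * (g x)^*%C).
Proof.
move=> [fr fi] [gr gi]; split.
  apply: (eq_measurable_fun (fun x => complex.Re (f x) * complex.Re (g x) +
      complex.Im (f x) * complex.Im (g x))).
    by move=> x _; case: (f x) (g x) => a b [c e] /=; rewrite mulrN opprK.
  by apply: measurable_realfun.measurable_funD; apply: measurable_funM.
apply: (eq_measurable_fun (fun x => complex.Im (f x) * complex.Re (g x) -
    complex.Re (f x) * complex.Im (g x))).
  by move=> x _; case: (f x) (g x) => a b [c e] /=; rewrite mulrN addrC.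
by apply: measurable_funB; apply: measurable_funM.
Qed.

Definition square_integrable f :=
  cmeasurable f /\ (\int[m]_x (Normc.normc (f x) ^+ 2)%:E < +oo)%E.

End complex_integral.

Section L2.
Context d (T : measurableType d) (R : realType).
Variable m : {measure set T -> \bar R}.

Definition square_integrable_pred : pred (T -> R[i]^o) :=
  fun f => `[< square_integrable m f >].

Record L2fun := MkL2fun {
  l2fun :> T -> R[i]^o;
  _ : l2fun \in square_integrable_pred }.

HB.instance Definition _ := [isSub for l2fun].
HB.instance Definition _ := [Choice of L2fun by <:].

Lemma square_integrableP (f : T -> R[i]^o) :
  reflect (square_integrable m f) (f \in square_integrable_pred).
Proof. exact: asboolP. Qed.

Lemma normc_sqr (z : R[i]) :
  Normc.normc z ^+ 2 = complex.Re z ^+ 2 + complex.Im z ^+ 2.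
Proof. by case: z => a b /=; rewrite sqr_sqrtr// addr_ge0// sqr_ge0. Qed.

Lemma measurable_normc_sqr (f : T -> R[i]^o) : cmeasurable f ->
  measurable_fun setT (fun x => (Normc.normc (f x) ^+ 2)%:E : \bar R).
Proof.
move=> [mr mi]; apply/measurable_EFinP.
under eq_fun do rewrite normc_sqr.
by apply: measurable_funD; apply: measurable_funX.
Qed.

Lemma square_integrable_submod_closed : submod_closed square_integrable_pred.
Proof.
split.
  apply/square_integrableP; split; first by split; exact: measurable_cst.
  rewrite integral0_eq// => x _.
  by rewrite normc_sqr /= !expr0n /= addr0.
move=> a f g /square_integrableP[mf lf] /square_integrableP[mg lg].
have mh : cmeasurable (a *: f + g).
  case: a mf mg => a b [mfr mfi] [mgr mgi]; split.
    apply: (eq_measurable_fun (fun x => (a * complex.Re (f x) -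
        b * complex.Im (f x)) + complex.Re (g x))).
      move=> x _; rewrite -[RHS]/(complex.Re ((a +i* b)%C * f x + g x)).
      by case: (f x) (g x) => ? ? [].
    apply: measurable_realfun.measurable_funD => //.
    by apply: measurable_funB; apply: measurable_funM.
  apply: (eq_measurable_fun (fun x => (a * complex.Im (f x) +
      b * complex.Re (f x)) + complex.Im (g x))).
    move=> x _; rewrite -[RHS]/(complex.Im ((a +i* b)%C * f x + g x)).
    by case: (f x) (g x) => ? ? [].
  apply: measurable_realfun.measurable_funD => //.
  by apply: measurable_realfun.measurable_funD; apply: measurable_funM.
apply/square_integrableP; split => //.
pose N (z : R[i]) := Normc.normc z.
pose F x := ((2 * N a ^+ 2)%:E * (N (f x) ^+ 2)%:E + 2%:E * (N (g x) ^+ 2)%:E)%E.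
have mF : measurable_fun setT F.
  by apply: emeasurable_funD; apply: measurable_funeM; exact: measurable_normc_sqr.
apply: (@le_lt_trans _ _ (\int[m]_x F x)%E).
  apply: ge0_le_integral => //.
  - by move=> x _; rewrite lee_fin sqr_ge0.
  - exact: measurable_normc_sqr.
  - move=> x _; rewrite /F -!EFinM -EFinD lee_fin.
    rewrite (_ : (a *: f + g) x = a * f x + g x)//.
    rewrite -mulrA -exprMn -Normc.normcM !normc_sqr.
    case: (a * f x : R[i]) => u v; case: (g x) => u' v' /=.
    rewrite -subr_ge0 (_ : _ - _ = (u - u') ^+ 2 + (v - v') ^+ 2).
      by rewrite addr_ge0// sqr_ge0.
    by ring.
have a0 : 0 <= 2 * N a ^+ 2 by rewrite mulr_ge0// sqr_ge0.
rewrite ge0_integralD//.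
- rewrite !ge0_integralZl//; try exact: measurable_normc_sqr;
    try (by move=> x _; rewrite lee_fin sqr_ge0).
  by rewrite lte_add_pinfty// lte_mul_pinfty// lee_fin.
- by move=> x _; rewrite -EFinM lee_fin mulr_ge0// sqr_ge0.
- by apply: measurable_funeM; exact: measurable_normc_sqr.
- by move=> x _; rewrite -EFinM lee_fin mulr_ge0// sqr_ge0.
- by apply: measurable_funeM; exact: measurable_normc_sqr.
Qed.

HB.instance Definition _ := GRing.isSubmodClosed.Build R[i] (T -> R[i]^o)
  square_integrable_pred square_integrable_submod_closed.
HB.instance Definition _ := [SubChoice_isSubLmodule of L2fun by <:].

Definition ae_zero : pred L2fun := fun f => `[< {ae m, forall x, f x = 0} >].

Lemma ae_zeroP (f : L2fun) :
  reflect {ae m, forall x, f x = 0} (f \in ae_zero).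
Proof. exact: asboolP. Qed.

Lemma ae_zero_submod_closed : submod_closed ae_zero.
Proof.
split; first by apply/ae_zeroP; apply: aeW.
move=> a f g /ae_zeroP f0 /ae_zeroP g0; apply/ae_zeroP.
apply: filterS2 f0 g0 => x fx gx.
by rewrite -[LHS]/(a * f x + g x) fx gx mulr0 addr0.
Qed.

HB.instance Definition _ :=
  GRing.isSubmodClosed.Build R[i] L2fun ae_zero ae_zero_submod_closed.

Definition ae_zero_zmod := GRing.ZmodClosed.clone L2fun ae_zero _.

Definition L2 : Type := {ideal_quot ae_zero_zmod}.

HB.instance Definition _ := GRing.Zmodule.on L2.
HB.instance Definition _ := Quotient.on L2.

Definition L2class (f : L2fun) : L2 := \pi_L2 f.

Lemma L2class_eqP (f g : L2fun) :
  L2class f = L2class g <-> {ae m, forall x, f x = g x}.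
Proof.
have -> : (L2class f = L2class g) = (f - g \in ae_zero).
  apply/propext; rewrite (Quotient.idealrBE ae_zero_zmod f g); by split=> [h|/eqP//]; apply/eqP.
split=> [/ae_zeroP|] fg.
  by apply: filterS fg => x /eqP; rewrite -[_ x]/(f x - g x) subr_eq0 => /eqP.
apply/ae_zeroP; apply: filterS fg => x fgx.
by rewrite -[LHS]/(f x - g x) fgx subrr.
Qed.

Definition L2scale (a : R[i]) (u : L2) : L2 := L2class (a *: repr u).

Lemma ae_repr_L2class (f : L2fun) : {ae m, forall x, repr (L2class f) x = f x}.
Proof. by apply/L2class_eqP; rewrite /L2class reprK. Qed.

Lemma L2classZ a f : L2class (a *: f) = L2scale a (L2class f).
Proof.
apply/L2class_eqP; apply: filterS (ae_repr_L2class f) => x fx.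
by rewrite -[LHS]/(a * f x) -[RHS]/(a * repr (L2class f) x) fx.
Qed.

Lemma L2classD f g : L2class (f + g) = L2class f + L2class g.
Proof. exact: Quotient.pi_add. Qed.

Lemma L2class_repr u : L2class (repr u) = u.
Proof. exact: reprK. Qed.

Lemma L2scaleA a b u : L2scale a (L2scale b u) = L2scale (a * b) u.
Proof. by rewrite -(L2class_repr u) -!L2classZ scalerA. Qed.

Lemma L2scale1 : left_id 1 L2scale.
Proof. by move=> u; rewrite -(L2class_repr u) -!L2classZ scale1r. Qed.

Lemma L2scaleDr : right_distributive L2scale +%R.
Proof.
move=> a u v; rewrite -(L2class_repr u) -(L2class_repr v).
by rewrite -L2classD -!L2classZ scalerDr L2classD.
Qed.

Lemma L2scaleDl u : {morph L2scale^~ u : a b / a + b}.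
Proof. by move=> a b; rewrite -(L2class_repr u) -!L2classZ scalerDl L2classD. Qed.

HB.instance Definition _ := GRing.Zmodule_isLmodule.Build R[i] L2
  L2scaleA L2scale1 L2scaleDr L2scaleDl.

Definition L2dot (u v : L2) : R[i] :=
  cint m (fun x => repr u x * (repr v x)^*%C).

Lemma L2fun_measurable (f : L2fun) : cmeasurable f.
Proof. by case: f => f /= /square_integrableP[]. Qed.

Lemma L2dot_class (f g : L2fun) :
  L2dot (L2class f) (L2class g) = cint m (fun x => f x * (g x)^*%C).
Proof.
apply: eq_ae_cint; try by apply: cmeasurableMJ; exact: L2fun_measurable.
by apply: filterS2 (ae_repr_L2class f) (ae_repr_L2class g) => x -> ->.
Qed.

Definition L2norm (u : L2) : R := Num.sqrt (complex.Re (L2dot u u)).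

Record bounded_operator := BoundedOperator {
  operator :> {linear L2 -> L2};
  _ : exists c : R, forall u, L2norm (operator u) <= c * L2norm u }.

Definition adjoint_operator (S T : bounded_operator) :=
  forall u v, L2dot (S u) v = L2dot u (T v).

End L2.

Section hecke_algebra.
Variables (G : topGroupType) (H : groupClosed G) (R : realType).
Implicit Types f g : right_cosets H -> R[i]^o.

Definition Cc (X : topologicalType) (f : X -> R[i]^o) :=
  continuous f /\ precompact [set x | f x != 0].

Definition hecke_pred : pred (right_cosets H -> R[i]^o) :=
  fun f => `[< Cc f /\
    forall x h, h \in H -> f (coset H (x * h)%g) = f (coset H x) >].

Record hecke := Hecke {
  hecke_fun :> right_cosets H -> R[i]^o;
  _ : hecke_fun \in hecke_pred }.

HB.instance Definition _ := [isSub for hecke_fun].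
HB.instance Definition _ := [Choice of hecke by <:].

Lemma heckeP f : reflect
  (Cc f /\ forall x h, h \in H -> f (coset H (x * h)%g) = f (coset H x))
  (f \in hecke_pred).
Proof. exact: asboolP. Qed.

Lemma continuous_linear_comb (X : topologicalType) (a : R[i]) (u v : X -> R[i]^o) :
  continuous u -> continuous v -> continuous (fun x => a *: u x + v x).
Proof.
move=> cu cv x; apply: (@cvgD R[i] R[i]^o); last exact: cv.
by apply: cvgZl_tmp; exact: cu.
Qed.

Lemma hecke_submod_closed : submod_closed hecke_pred.
Proof.
split.
  apply/heckeP; split=> //; split; first exact: (@cst_continuous _ _ (0 : R[i]^o)).
  rewrite (_ : [set _ | _] = set0).
    by rewrite precompactE closure0; exact: compact0.
  by rewrite -subset0 => x /=; rewrite eqxx.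
move=> a f g /heckeP[[cf +] hf] /heckeP[[cg +] hg].
rewrite !precompactE => kf kg; apply/heckeP; split.
  split.
    exact: (continuous_linear_comb cf cg).
  rewrite precompactE.
  apply: (subclosed_compact (@closed_closure _ _) (compactU kf kg)).
  rewrite -closureU; apply: closureS => x /=.
  rewrite -[(a *: f + g) x]/(a * f x + g x).
  have [->|] := eqVneq (f x) 0; last by left.
  by rewrite mulr0 add0r; right.
move=> x h Hh.
by rewrite -[LHS]/(a * f _ + g _) -[RHS]/(a * f _ + g _) hf// hg.
Qed.

HB.instance Definition _ := GRing.isSubmodClosed.Build R[i]
  (right_cosets H -> R[i]^o) hecke_pred hecke_submod_closed.
HB.instance Definition _ := [SubChoice_isSubLmodule of hecke by <:].

Variable nu : {measure set (borel (right_cosets H)) -> \bar R}.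

(* For [f] in the Hecke algebra, [f (coset H (x * y^-1))] depends only on the
   cosets of [x] and [y] (see [hecke_repr]); elsewhere the value below depends
   on the representatives chosen by [repr]. *)
Definition hconv f g (X : right_cosets H) : R[i] :=
  cint nu (fun Y : borel (right_cosets H) =>
    f (coset H (repr X * (repr (Y : right_cosets H))^-1)%g) * g Y).

Lemma repr_coset x : exists2 h, h \in H & repr (coset H x) = (h * x)%g.
Proof.
exists (repr (coset H x) * x^-1)%g; last by rewrite -mulgA mulVg mulg1.
by apply/cosetP; rewrite /coset reprK.
Qed.

Lemma hecke_repr (f : hecke) x y :
  f (coset H (repr (coset H x) * (repr (coset H y))^-1)%g) =
  f (coset H (x * y^-1)%g).
Proof.
have [h Hh ->] := repr_coset x; have [k Hk ->] := repr_coset y.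
case: f => f /= /heckeP[_ fH].
rewrite invgM mulgA fH ?gpredV// -mulgA; congr f; apply/cosetP.
by rewrite mulgK.
Qed.

(* The inner integral does not depend on the representative of [Y] when [eta] is
   right invariant. *)
Definition weil_formula (mu : {measure set (borel G) -> \bar R})
    (eta : {measure set (borel (subgroup H)) -> \bar R}) :=
  forall f : G -> R[i]^o, Cc f ->
    cint mu f = cint nu (fun Y : borel (right_cosets H) =>
      cint eta (fun h : borel (subgroup H) =>
        f (val (h : subgroup H) * repr (Y : right_cosets H))%g)).

End hecke_algebra.

(* Main.v *)
Require Import Defs.
From HB Require Import structures.
From mathcomp Require Import all_boot all_order all_algebra.
From mathcomp Require Import complex.
From mathcomp Require Import all_classical all_reals all_analysis.
From mathcomp Require Import ring lra.
From mathcomp Require Import measurable_realfun.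

Set Implicit Arguments.
Unset Strict Implicit.
Unset Printing Implicit Defensive.

Import Order.TTheory GRing.Theory Num.Theory.
Import numFieldNormedType.Exports.

Local Open Scope classical_set_scope.
Local Open Scope ring_scope.
Local Open Scope quotient_scope.

(** Write [M] for the space of right cosets and [F (Hx, Hy) = f (H x y^-1)] for
    the kernel of an element [f] of the Hecke algebra, so that [f * xi] is the
    integral operator with kernel [F]. As [nu] is finite, its character is
    trivial: [nu] and [F] are invariant under the right action of [G]. The
    operators are bounded for a cheap reason: [F] is bounded and [L^2] is
    contained in [L^1], so [f * xi] is a bounded function whose supremum is
    controlled by the [L^2] norm of [xi].

    The delicate point is that [f^*] must have compact support. For [x] in the
    support of [f], the cosets [H x] form a relatively compact set, but those of
    the inverses [x^-1] could a priori leave every compact subset of [M]. They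
    cannot, because a Hecke algebra containing some [f <> 0] exists only over a
    compact [M] ([compact_of_kernel], [hecke_compact]). Indeed, replace [f] by its
    modulus and let [T] be the operator with kernel [F]. It commutes with [G].
    The translates of [T f] form an equicontinuous bounded family; as [nu] is
    finite and inner regular, this family is totally bounded in [L^1]
    ([equicontinuous_finite_net]), and [T] maps [L^1] to bounded functions, so the
    translates of [T (T f)] are totally bounded for the supremum norm. Since
    [T (T f)] has compact support, up to [d] all of its translates vanish outside
    one compact set; by transitivity of [G], a point outside this set would give
    [T (T f) <= d] everywhere. But [T (T f)] is positive somewhere, so for small
    [d] there is no such point and [M] is compact.

    From then on one may assume [M] compact, [f = 0] being trivial. Supports are
    no longer an issue. The modular function of [G] is trivial on [H] by the Weil
    formula ([modular_subgroup]), so it descends to [M], where it is locally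
    bounded, hence bounded; a bounded positive character is [1] ([modular_eq1]).
    The kernels are uniform limits of kernels of finite rank in the first
    variable, hence measurable for the product of the Borel sigma-algebras
    ([measurable_joint_continuous]), and Fubini's theorem applies to them
    ([cint_kernel_fubini]). Together with the invariance of [nu] it yields
    [(f * g) * xi = f * (g * xi)] and the adjointness of [f] and [f^*]. *)

(** * Topology of the group and of its coset space *)

Lemma compact_finite_nbhs (T : ptopologicalType) (K : set T) (N : T -> set T) :
    compact K -> (forall x, K x -> nbhs x (N x)) ->
  exists s : seq T, forall y, K y -> exists2 x, x \in s & N x y.
Proof.
rewrite compact_cover => cK nN.
have [||s _ Ks] := cK T K (fun x => (N x)^°); first by move=> x _; exact: open_interior.
  by move=> x Kx; exists x => //; exact: nN.
exists (finmap.enum_fset s) => y /Ks[x /= xs Ny]; exists x => //.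
exact: interior_subset.
Qed.

Section joint_continuity.
Variables (X Y : topologicalType).

Lemma joint_continuous_r (Z : topologicalType) (F : X -> Y -> Z) x y :
  F p.1 p.2 @[p --> (x, y)] --> F x y -> F x y' @[y' --> y] --> F x y.
Proof.
move=> cF; have c : (x, y') @[y' --> y] --> (x, y).
  by apply: (cvg_pair (G := nbhs x) (H := nbhs y)); [exact: cvg_cst|exact: cvg_id].
exact: (cvg_comp _ (fun p => F p.1 p.2) c cF).
Qed.

Lemma joint_continuous_l (Z : topologicalType) (F : X -> Y -> Z) x y :
  F p.1 p.2 @[p --> (x, y)] --> F x y -> F x' y @[x' --> x] --> F x y.
Proof.
move=> cF; have c : (x', y) @[x' --> x] --> (x, y).
  by apply: (cvg_pair (G := nbhs x) (H := nbhs y)); [exact: cvg_id|exact: cvg_cst].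
exact: (cvg_comp _ (fun p => F p.1 p.2) c cF).
Qed.

(** The tube lemma, in metric form. *)
Lemma tube_near (K : numFieldType) (V : normedModType K) (F : X -> Y -> V)
    (E : set Y) x e :
    compact E -> (forall y, F p.1 p.2 @[p --> (x, y)] --> F x y) -> 0 < e ->
  \forall x' \near x, forall y, E y -> `|F x' y - F x y| < e.
Proof.
move=> /compact_near_coveringP cE cF e0.
apply: (cE _ _ (fun x' y => `|F x' y - F x y| < e)) => y Ey.
have c1 : (p.2, p.1) @[p --> (y, x)] --> (x, y).
  by apply: (cvg_pair (G := nbhs x) (H := nbhs y)); [exact: cvg_snd|exact: cvg_fst].
have c2 : p.1 @[p --> (y, x)] --> y by exact: cvg_fst.
have {}c1 := cvg_comp _ (fun p => F p.1 p.2) c1 (cF y).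
have {}c2 := cvg_comp _ (F x) c2 (joint_continuous_r (cF y)).
have /cvgr0Pnorm_lt : F p.2 p.1 - F x p.1 @[p --> (y, x)] --> 0.
  by rewrite -(subrr (F x y)); exact: cvgB.
exact.
Qed.

End joint_continuity.

Section group_topology.
Variable G : topGroupType.
Implicit Types x y : G.

Lemma cvg_mulg (T : Type) (F : set_system T) (FF : Filter F) (f g : T -> G) x y :
  f @ F --> x -> g @ F --> y -> (f t * g t)%g @[t --> F] --> (x * y)%g.
Proof.
move=> fx gy; apply: (@cvg_comp _ _ _ (fun t => (f t, g t))
  (fun q : G * G => (q.1 * q.2)%g) F (nbhs (x, y))).
  exact: (cvg_pair (G := nbhs x) (H := nbhs y)).
by have := @mulg_continuous G (x, y).
Qed.

Lemma cvg_invg (T : Type) (F : set_system T) (FF : Filter F) (f : T -> G) x :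
  f @ F --> x -> (f t)^-1%g @[t --> F] --> x^-1%g.
Proof. by move=> fx; apply: cvg_comp fx _; exact: invg_continuous. Qed.

Lemma continuous_mulgr x : continuous (fun y : G => (y * x)%g).
Proof. by move=> y; apply: cvg_mulg; [exact: cvg_id|exact: cvg_cst]. Qed.

Lemma continuous_mulgl x : continuous (fun y : G => (x * y)%g).
Proof. by move=> y; apply: cvg_mulg; [exact: cvg_cst|exact: cvg_id]. Qed.

Lemma image_mulgr x (E : set G) :
  [set (y * x)%g | y in E] = (fun y => (y * x^-1)%g) @^-1` E.
Proof.
apply/seteqP; split=> [_ [y Ey <-]|y Ey] /=; first by rewrite mulgK.
by exists (y * x^-1)%g => //; rewrite mulgVK.
Qed.

Lemma image_mulgl x (E : set G) :
  [set (x * y)%g | y in E] = (fun y => (x^-1 * y)%g) @^-1` E.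
Proof.
apply/seteqP; split=> [_ [y Ey <-]|y Ey] /=; first by rewrite mulKg.
by exists (x^-1 * y)%g => //; rewrite mulVKg.
Qed.

Lemma compact_mulg (A B : set G) : compact A -> compact B ->
  compact [set (p.1 * p.2)%g | p in A `*` B].
Proof.
move=> cA cB; apply: continuous_compact; last exact: compact_setX.
by apply: continuous_subspaceT => p; exact: mulg_continuous.
Qed.

End group_topology.

Section coset_topology.
Variables (G : topGroupType) (H : groupClosed G).
Local Notation M := (right_cosets H).
Local Notation coset := (coset H).
Implicit Types X Y : M.

Lemma cosetK X : coset (repr X) = X.
Proof. by rewrite /Defs.coset reprK. Qed.

Lemma coset_mulr x h : h \in H -> coset (h * x)%g = coset x.
Proof. by move=> Hh; apply/cosetP; rewrite mulgK. Qed.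

Lemma continuous_coset : continuous coset.
Proof. exact: pi_continuous. Qed.

Lemma open_coset (U : set G) : open U -> open (coset @` U).
Proof.
move=> oU; rewrite [open _]/(open (\pi_M @^-1` (coset @` U))).
rewrite (_ : _ @^-1` _ =
    \bigcup_(h in [set h | h \in H]) (fun x => (h * x)%g) @^-1` U); last first.
  apply/seteqP; split=> x /=.
    move=> [u Uu /cosetP ux]; exists (u * x^-1)%g => //=.
    by rewrite -mulgA mulVg mulg1.
  by move=> [h Hh Uhx]; exists (h * x)%g => //; exact: coset_mulr.
apply: bigcup_open => h _; apply: open_comp => // x _.
exact: continuous_mulgl.
Qed.

(** The projection is continuous and open, so that local properties of functions
    on the quotient can be checked on the group. *)
Lemma nbhs_coset x (U : set M) :
  nbhs (coset x) U <-> (\forall y \near x, U (coset y)).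
Proof.
split=> [|]; first exact: continuous_coset.
rewrite {1}/prop_near1 {1}nbhsE => -[V [oV Vx] VU]; apply: (@filterS _ _ _ (coset @` V)).
  by move=> _ [v /VU Uv <-].
by apply: open_nbhs_nbhs; split; [exact: open_coset|exists x].
Qed.

Lemma continuous_coset_act x : continuous (fun X => coset_act X x).
Proof.
move=> X; rewrite -(cosetK X) => U; rewrite coset_actE => /nbhs_coset nU.
apply/nbhs_coset; near=> y; rewrite /= coset_actE.
by near: y; exact: (continuous_mulgr nU).
Unshelve. all: by end_near. Qed.

Lemma coset_actM X x y : coset_act (coset_act X x) y = coset_act X (x * y)%g.
Proof. by rewrite -(cosetK X) !coset_actE mulgA. Qed.

Lemma coset_act1 X : coset_act X 1%g = X.
Proof. by rewrite -{1}(cosetK X) coset_actE mulg1 cosetK. Qed.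

Lemma image_coset_act x (E : set M) :
  [set coset_act X x | X in E] = (fun X => coset_act X x^-1%g) @^-1` E.
Proof.
apply/seteqP; split=> [_ [y Ey <-]|y Ey] /=.
  by rewrite coset_actM mulgV coset_act1.
by exists (coset_act y x^-1%g) => //; rewrite coset_actM mulVg coset_act1.
Qed.

(** Two points whose difference avoids the closed set [H] have neighborhoods
    whose difference still avoids [H]; their images in the quotient are disjoint. *)
Lemma hausdorff_cosets : closed [set x : G | x \in H] -> hausdorff_space M.
Proof.
move=> clH X Y; rewrite -(cosetK X) -(cosetK Y).
set x := repr X; set y := repr Y => cxy; apply/cosetP; apply: contrapT => nH.
have oU : open (~` [set x : G | x \in H]) by rewrite openC.
have : \forall p \near (x, y), (~` [set x : G | x \in H]) (p.1 * p.2^-1)%g.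
  have c : (p.1 * p.2^-1)%g @[p --> (x, y)] --> (x * y^-1)%g.
    apply: cvg_mulg; first exact: cvg_fst.
    by apply: cvg_invg; exact: cvg_snd.
  by apply: c; exact: open_nbhs_nbhs.
case=> -[U V] [/= Ux Vy] UV.
have [] := cxy (coset @` U) (coset @` V).
- by apply/nbhs_coset; apply: filterS Ux => u Uu; exists u.
- by apply/nbhs_coset; apply: filterS Vy => u Uu; exists u.
move=> _ [[u Uu <-] [v Vv /cosetP uv]]; apply: (UV (u, v)) => //=.
by rewrite -[_ \in _]gpredV invgM invgK in uv.
Qed.

Lemma compact_nbhs_group : locally_compact [set: G] ->
  forall x : G, exists2 K : set G, nbhs x K & compact K.
Proof.
move=> lc x; have [K nK [cK _]] := lc x Logic.I.
by exists K => //; apply: (@filterS G (nbhs x) _ [set y | True -> K y]) => // y; apply.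
Qed.

(** A compact set of cosets is covered by the images of finitely many compact
    neighborhoods in the group. *)
Lemma compact_lift (D : set M) : locally_compact [set: G] -> compact D ->
  exists2 K : set G, compact K & D `<=` coset @` K.
Proof.
move=> /compact_nbhs_group lc cD.
pose N x := projT1 (cid2 (lc x)).
have nN x : nbhs x (N x) by rewrite /N; case: cid2.
have cN x : compact (N x) by rewrite /N; case: cid2.
have [|s Ds] := compact_finite_nbhs (N := fun X => coset @` N (repr X)) cD.
  move=> X _; rewrite -{1}(cosetK X); apply/nbhs_coset.
  by apply: filterS (nN (repr X)) => x; exists x.
exists (\big[setU/set0]_(X <- s) N (repr X)); first exact: bigsetU_compact.
by move=> X /Ds[Y sY [x Nx <-]]; exists x => //; rewrite -bigcup_seq; exists Y.
Qed.

Section kernel.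
Variables (V : topologicalType) (f : M -> V).
Hypothesis fH : forall x h, h \in H -> f (coset (x * h)%g) = f (coset x).

(** By [kernelE] the choice of representatives does not matter; this form is the
    one that occurs in the convolution product. *)
Definition coset_kernel X Y : V := f (coset (repr X * (repr Y)^-1)%g).

Lemma kernelE x y : coset_kernel (coset x) (coset y) = f (coset (x * y^-1)%g).
Proof.
have [h Hh hx] := repr_coset H x; have [k Hk ky] := repr_coset H y.
rewrite /coset_kernel hx ky invgM mulgA fH ?gpredV// -mulgA.
by congr f; exact: coset_mulr.
Qed.

Lemma kernel_act X Y x : coset_kernel (coset_act X x) (coset_act Y x) = coset_kernel X Y.
Proof.
rewrite -(cosetK X) -(cosetK Y) !coset_actE !kernelE.
by rewrite invgM -!mulgA mulVKg.
Qed.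

Lemma cvg_kernel X Y : continuous f ->
  coset_kernel p.1 p.2 @[p --> (X, Y)] --> coset_kernel X Y.
Proof.
move=> cf; rewrite -(cosetK X) -(cosetK Y).
move: (repr X) (repr Y) => {X Y} x y W; rewrite kernelE => nW.
have c : f (coset (p.1 * p.2^-1)%g) @[p --> (x, y)] --> f (coset (x * y^-1)%g).
  apply: cvg_comp; last exact: cf.
  apply: cvg_comp; last exact: continuous_coset.
  apply: cvg_mulg; first exact: cvg_fst.
  by apply: cvg_invg; exact: cvg_snd.
have [[A B] [/= nA nB] AB] := c _ nW.
exists (coset @` A, coset @` B) => /=.
  split; apply/nbhs_coset; [apply: filterS nA|apply: filterS nB] => z; by exists z.
move=> [_ _] [[/= a Aa <-] [b Bb <-]]; rewrite kernelE.
exact: (AB (a, b)).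
Qed.

Lemma continuous_kernel_r X : continuous f -> continuous (coset_kernel X).
Proof. by move=> cf Y; apply: joint_continuous_r; exact: cvg_kernel. Qed.

Lemma continuous_kernel_l Y : continuous f -> continuous (coset_kernel ^~ Y).
Proof.
by move=> cf X; apply: (joint_continuous_l (F := coset_kernel)); exact: cvg_kernel.
Qed.

End kernel.

End coset_topology.

(** * Integration of complex functions *)

Section modulus.
Variable R : realType.
Implicit Types z w : R[i].
Local Notation normc := (@Normc.normc R).

Lemma normc_ge0 z : 0 <= normc z.
Proof. by case: z => a b; exact: sqrtr_ge0. Qed.

Lemma normr_complexE z : `|z| = (normc z)%:C%C.
Proof. by case: z. Qed.

Lemma normc_real (r : R) : normc r%:C%C = `|r|.
Proof. by rewrite /= expr0n addr0 sqrtr_sqr. Qed.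

Lemma normc_conj z : normc z^*%C = normc z.
Proof. by case: z => a b /=; rewrite sqrrN. Qed.

Lemma Re_le_normc z : `|complex.Re z| <= normc z.
Proof. by case: z => a b /=; rewrite -sqrtr_sqr ler_wsqrtr// lerDl sqr_ge0. Qed.

Lemma Im_le_normc z : `|complex.Im z| <= normc z.
Proof. by case: z => a b /=; rewrite -sqrtr_sqr ler_wsqrtr// lerDr sqr_ge0. Qed.

Lemma normc_le_ReIm z : normc z <= `|complex.Re z| + `|complex.Im z|.
Proof.
rewrite -[leRHS]ger0_norm ?addr_ge0// -sqrtr_sqr.
case: z => a b /=; rewrite ler_wsqrtr// sqrrD !real_normK ?num_real//.
by rewrite addrAC lerDl mulrn_wge0// mulr_ge0.
Qed.

Lemma normcN z : normc (- z) = normc z.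
Proof. by case: z => a b /=; rewrite !sqrrN. Qed.

Lemma ler_normcD z w : normc (z + w) <= normc z + normc w.
Proof. exact: le_normcD. Qed.

Lemma ReD z w : complex.Re (z + w) = complex.Re z + complex.Re w.
Proof. by case: z w => a b []. Qed.

Lemma ImD z w : complex.Im (z + w) = complex.Im z + complex.Im w.
Proof. by case: z w => a b []. Qed.

Lemma ReB z w : complex.Re (z - w) = complex.Re z - complex.Re w.
Proof. by case: z w => a b []. Qed.

Lemma ImB z w : complex.Im (z - w) = complex.Im z - complex.Im w.
Proof. by case: z w => a b []. Qed.

Lemma ler_dist_normc z w : `|normc z - normc w| <= normc (z - w).
Proof.
have h u v : normc u - normc v <= normc (u - v).
  by rewrite lerBlDr; have := ler_normcD (u - v) v; rewrite subrK.
by rewrite ler_norml h andbT -(opprB w z) normcN lerNl opprB h.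
Qed.

Lemma cvg_normcP (T : Type) (F : set_system T) (FF : Filter F)
    (f : T -> R[i]^o) (z : R[i]^o) :
  f @ F --> z <-> forall e : R, 0 < e -> \forall t \near F, normc (z - f t) < e.
Proof.
split=> [/cvgrPdist_lt fz e e0|fz].
  have := fz e%:C%C; rewrite ltcR => /(_ e0).
  by apply: filterS => t; rewrite normr_complexE ltcR.
apply/cvgrPdist_lt => e; rewrite ltcE => /andP[/= /eqP e0 eR].
have -> : e = (complex.Re e)%:C%C by case: e e0 {eR} => a b /= ->.
by apply: filterS (fz _ eR) => t; rewrite normr_complexE ltcR.
Qed.

Lemma near_normc (z : R[i]^o) (e : R) : 0 < e -> \forall w \near z, normc (z - w) < e.
Proof.
by move: e; apply: (cvg_normcP (nbhs_filter z) id z).1; exact: cvg_id.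
Qed.

Lemma continuous_Re : continuous (@complex.Re R : R[i]^o -> R).
Proof.
move=> z; apply/(@cvgrPdist_lt _ _ _ _ (nbhs_filter z)) => e e0.
move: (near_normc z e0).
apply: filterS => w; apply: le_lt_trans; rewrite -ReB.
exact: Re_le_normc.
Qed.

Lemma continuous_Im : continuous (@complex.Im R : R[i]^o -> R).
Proof.
move=> z; apply/(@cvgrPdist_lt _ _ _ _ (nbhs_filter z)) => e e0.
move: (near_normc z e0).
apply: filterS => w; apply: le_lt_trans; rewrite -ImB.
exact: Im_le_normc.
Qed.

Lemma continuous_normc : continuous (@Normc.normc R : R[i]^o -> R).
Proof.
move=> z; apply/(@cvgrPdist_lt _ _ _ _ (nbhs_filter z)) => e e0.
move: (near_normc z e0).
by apply: filterS => w; apply: le_lt_trans; exact: ler_dist_normc.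
Qed.

Lemma continuous_conjc : continuous (@conjc R : R[i]^o -> R[i]^o).
Proof.
move=> z; apply/(cvg_normcP (nbhs_filter z)) => e e0.
move: (near_normc z e0).
by apply: filterS => w; rewrite -rmorphB normc_conj.
Qed.

Lemma continuous_real_complex : continuous (fun r : R => r%:C%C : R[i]^o).
Proof.
move=> r; apply/(cvg_normcP (nbhs_filter r)) => e e0.
have /cvgrPdist_lt/(_ _ e0) : (t : R) @[t --> r] --> r by exact: cvg_id.
by apply: filterS => w; rewrite -rmorphB normc_real.
Qed.

End modulus.

Section borel_functions.
Variable R : realType.

Lemma borel_open (T : ptopologicalType) (U : set T) :
  open U -> measurable (U : set (borel T)).
Proof. by move=> oU; exact: sub_sigma_algebra. Qed.

Lemma borel_closed (T : ptopologicalType) (F : set T) :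
  closed F -> measurable (F : set (borel T)).
Proof.
by move=> cF; rewrite -[F]setCK; apply: measurableC; apply: borel_open; rewrite openC.
Qed.

Lemma borel_continuous (S T : ptopologicalType) (a : S -> T) :
  continuous a -> measurable_fun setT (a : borel S -> borel T).
Proof.
move=> /continuousP ca.
apply: (@measurability _ _ (borel S) (borel T) _ _ (@open T)) => // _ [U oU <-].
by rewrite setTI; apply: borel_open; exact: ca.
Qed.

Lemma borel_continuous_real (T : ptopologicalType) (f : T -> R) :
  continuous f -> measurable_fun setT (f : borel T -> R).
Proof.
move=> /continuousP cf; apply: (measurability _ (RGenOpens.measurableE R)).
move=> _ [_ [a [b ->] <-]]; rewrite setTI; apply: borel_open; apply: cf.
exact: interval_open.
Qed.

Lemma borel_continuous_complex (T : ptopologicalType) (f : T -> R[i]^o) :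
  continuous f -> cmeasurable (f : borel T -> R[i]^o).
Proof.
move=> cf; split; apply: borel_continuous_real => x;
  apply: continuous_comp; [exact: cf|exact: continuous_Re|exact: cf|exact: continuous_Im].
Qed.

End borel_functions.

Section complex_integration.
Context d (T : measurableType d) (R : realType).
Variable m : {measure set T -> \bar R}.
Implicit Types (f g : T -> R[i]^o) (u v : T -> R).
Local Notation normc := (@Normc.normc R).

Lemma cmeasurable_cst (a : R[i]) : cmeasurable (fun _ : T => a : R[i]^o).
Proof. by split; exact: measurable_cst. Qed.

Lemma eq_cmeasurable f g : f =1 g -> cmeasurable f -> cmeasurable g.
Proof. by move=> /funext ->. Qed.

Lemma cmeasurable_conj f : cmeasurable f -> cmeasurable (fun x => (f x)^*%C).
Proof.
move=> /(cmeasurableMJ (cmeasurable_cst 1)); apply: eq_cmeasurable => x.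
by rewrite mul1r.
Qed.

Lemma cmeasurableM f g : cmeasurable f -> cmeasurable g ->
  cmeasurable (fun x => f x * g x).
Proof.
move=> mf /cmeasurable_conj /(cmeasurableMJ mf); apply: eq_cmeasurable => x.
by rewrite conjcK.
Qed.

Lemma cmeasurableD f g : cmeasurable f -> cmeasurable g ->
  cmeasurable (fun x => f x + g x).
Proof.
move=> [fr fi] [gr gi]; split; under eq_fun do rewrite ?ReD ?ImD;
  exact: measurable_realfun.measurable_funD.
Qed.

Lemma measurable_normc f : cmeasurable f -> measurable_fun setT (fun x => normc (f x)).
Proof.
move=> /measurable_normc_sqr/measurable_EFinP mf.
rewrite (_ : (fun x => _) = (fun x => Num.sqrt (normc (f x) ^+ 2))); last first.
  by apply/funext => x; rewrite sqrtr_sqr ger0_norm// normc_ge0.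
apply: measurableT_comp => //; apply: continuous_measurable_fun; exact: sqrt_continuous.
Qed.

Lemma cintegrable_le f u : cmeasurable f -> m.-integrable setT (EFin \o u) ->
  (forall x, normc (f x) <= u x) -> cintegrable m f.
Proof.
move=> [fr fi] iu fu; split; apply: (le_integrable measurableT _ _ iu).
- exact/measurable_EFinP.
- move=> x _ /=; rewrite lee_fin (le_trans (Re_le_normc _))//.
  by rewrite (le_trans (fu x))// ler_norm.
- exact/measurable_EFinP.
- move=> x _ /=; rewrite lee_fin (le_trans (Im_le_normc _))//.
  by rewrite (le_trans (fu x))// ler_norm.
Qed.

Lemma cintegrable_measurable f : cintegrable m f -> cmeasurable f.
Proof.
by move=> [/integrableP[/measurable_EFinP ? _] /integrableP[/measurable_EFinP ? _]].
Qed.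

Lemma cintegrable_normc f : cintegrable m f ->
  m.-integrable setT (EFin \o (fun x => normc (f x))).
Proof.
move=> /[dup] /cintegrable_measurable mf [fr fi].
apply: (le_integrable measurableT _ _
  (integrableD measurableT (integrable_norm fr) (integrable_norm fi))).
  exact/measurable_EFinP/measurable_normc.
move=> x _; rewrite /= lee_fin [leLHS]ger0_norm ?normc_ge0//.
rewrite [leRHS]ger0_norm ?addr_ge0//; exact: normc_le_ReIm.
Qed.

Lemma cintegrableM f g (C : R) : cmeasurable f -> (forall x, normc (f x) <= C) ->
  cintegrable m g -> cintegrable m (fun x => f x * g x).
Proof.
move=> mf fC ig; apply: (@cintegrable_le _ (fun x => C * normc (g x))).
- by apply: cmeasurableM => //; exact: cintegrable_measurable ig.
- by apply: (eq_integrable measurableT _ _ _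
    (integrableZl measurableT C (cintegrable_normc ig))).
- by move=> x; rewrite Normc.normcM ler_wpM2r// normc_ge0.
Qed.

Lemma eq_cint f g : f =1 g -> cint m f = cint m g.
Proof. by move=> /funext ->. Qed.

Lemma cintD f g : cintegrable m f -> cintegrable m g ->
  cint m (fun x => f x + g x) = cint m f + cint m g.
Proof.
move=> [fr fi] [gr gi]; apply/eqP; rewrite eq_complex /=.
rewrite -!RintegralD//; apply/andP; split; apply/eqP; apply: eq_Rintegral => x _;
  by case: (f x) (g x) => ? ? [].
Qed.

Lemma cintZ a f : cintegrable m f -> cint m (fun x => a * f x) = a * cint m f.
Proof.
case: a => a b [fr fi]; apply/eqP; rewrite eq_complex /=.
have iZ (c : R) u : m.-integrable setT (EFin \o u) ->
    m.-integrable setT (EFin \o (fun x => c * u x)).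
  by move=> iu; apply: (eq_integrable measurableT _ _ _ (integrableZl measurableT c iu)).
rewrite -!RintegralZl// -RintegralB ?iZ// -RintegralD ?iZ//.
by apply/andP; split; apply/eqP; apply: eq_Rintegral => x _; case: (f x).
Qed.

Lemma cint_conj f : cintegrable m f -> cint m (fun x => (f x)^*%C) = (cint m f)^*%C.
Proof.
move=> [fr fi]; apply/eqP; rewrite eq_complex /=; apply/andP; split; apply/eqP.
  by apply: eq_Rintegral => x _; case: (f x).
rewrite -mulN1r -RintegralZl//.
by apply: eq_Rintegral => x _; rewrite mulN1r; case: (f x).
Qed.

(** The constant [2] comes from bounding the real and imaginary parts separately. *)
Lemma normc_cint_le f u : cmeasurable f -> m.-integrable setT (EFin \o u) ->
  (forall x, normc (f x) <= u x) -> normc (cint m f) <= 2 * \int[m]_x u x.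
Proof.
move=> mf iu fu; have [fr fi] := cintegrable_le mf iu fu.
rewrite (le_trans (normc_le_ReIm _))// mulr_natl mulr2n /=.
apply: lerD.
  rewrite (le_trans (le_normr_Rintegral measurableT fr))//.
  apply: le_Rintegral => //; first exact: integrable_norm.
  by move=> x _; exact: le_trans (Re_le_normc _) (fu x).
rewrite (le_trans (le_normr_Rintegral measurableT fi))//.
apply: le_Rintegral => //; first exact: integrable_norm.
by move=> x _; exact: le_trans (Im_le_normc _) (fu x).
Qed.

Section change_of_variables.
Variable phi : T -> T.
Hypothesis mphi : measurable_fun setT phi.

Lemma ge0_integral_scaled (c : R) (f : T -> \bar R) : 0 <= c ->
    (forall E, measurable E -> m (phi @^-1` E) = (c%:E * m E)%E) ->
    measurable_fun setT f -> (forall x, 0 <= f x)%E ->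
  (\int[m]_x f (phi x) = c%:E * \int[m]_x f x)%E.
Proof.
move=> c0 phi_m mf f0; pose c' := NngNum c0.
rewrite -(@ge0_integral_mscale _ _ _ m setT measurableT c' f)//.
rewrite -[LHS](@ge0_integral_pushforward _ _ _ _ _ phi mphi m setT f)//.
by apply: eq_measure_integral => A mA _; rewrite /= /pushforward phi_m.
Qed.

Hypothesis phi_m : forall E, measurable E -> m (phi @^-1` E) = m E.

Lemma integral_invariant (f : T -> \bar R) : measurable_fun setT f ->
  (\int[m]_x f (phi x) = \int[m]_x f x)%E.
Proof.
have phi1 E : measurable E -> m (phi @^-1` E) = (1%:E * m E)%E.
  by move=> mE; rewrite mul1e phi_m.
move=> mf; rewrite integralE [RHS]integralE; congr (_ - _)%E.
  rewrite -[RHS]mul1e -(ge0_integral_scaled ler01 phi1)//; last first.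
    exact: measurable_funepos.
  by rewrite -/(f \o phi) funepos_comp.
rewrite -[RHS]mul1e -(ge0_integral_scaled ler01 phi1)//; last first.
  exact: measurable_funeneg.
by rewrite -/(f \o phi) funeneg_comp.
Qed.

Lemma Rintegral_invariant u : measurable_fun setT u ->
  \int[m]_x u (phi x) = \int[m]_x u x.
Proof.
move=> mu; congr fine; apply: (integral_invariant (f := EFin \o u)).
exact/measurable_EFinP.
Qed.

Lemma cint_invariant f : cmeasurable f -> cint m (fun x => f (phi x)) = cint m f.
Proof.
move=> [fr fi]; rewrite /cint; congr Complex.
  exact: (Rintegral_invariant fr).
exact: (Rintegral_invariant fi).
Qed.

End change_of_variables.

End complex_integration.

(** * Bounds for measures *)

Section full_support.
Variables (R : realType) (T : ptopologicalType).
Variable m : {measure set (borel T) -> \bar R}.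
Hypotheses (hausdorffT : hausdorff_space T) (radon_m : radon m) (m_neq0 : m setT != 0%E).

(** Finitely many translates of [U] cover any compact set, so that a null [U]
    would make every compact set, hence the whole space, null. *)
Lemma open_measure_gt0 (I : Type) (a : I -> T -> T) (U : set T) : open U ->
    (forall i, continuous (a i)) -> (forall i, m (a i @^-1` U) = m U) ->
  (forall x, exists i, U (a i x)) -> (0 < m U)%E.
Proof.
move=> oU ca ma aU; rewrite lt_neqAle measure_ge0 andbT eq_sym.
apply/eqP => mU0; move/eqP : m_neq0; apply.
have [_ _ /(_ _ openT) ->] := radon_m.
apply/eqP; rewrite eq_le; apply/andP; split; last first.
  apply: ereal_sup_ubound; exists set0; last exact: measure0.
  by split => //; exact: compact0.
apply: ge_ereal_sup => _ [K [cK _] <-].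
have mK : measurable (K : set (borel T)).
  by apply: borel_closed; exact: compact_closed.
have oi i : open (a i @^-1` U) by apply: open_comp => // x _; exact: ca.
have ni i : m.-negligible (a i @^-1` U).
  by apply/negligibleP; [exact: borel_open|exact: etrans (ma i) mU0].
pose c x := projT1 (cid (aU x)).
have cU x : U (a (c x) x) by rewrite /c; case: cid.
have [|s Ks] := compact_finite_nbhs (N := fun x => a (c x) @^-1` U) cK.
  by move=> x _; apply: open_nbhs_nbhs; split; [exact: oi|exact: cU].
rewrite measure_negligible//.
have : m.-negligible (\big[setU/set0]_(x <- s) a (c x) @^-1` U).
  by elim/big_ind : _ => //; [exact: negligible_set0|move=> ? ?; exact: negligibleU].
by apply: negligibleS => y /Ks[x sx ?]; rewrite -bigcup_seq; exists x.
Qed.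

End full_support.

Section finite_measure_bounds.
Context d (T : measurableType d) (R : realType).
Variable m : {measure set T -> \bar R}.
Hypothesis m_fin : (m setT < +oo)%E.
Implicit Types h : T -> R.

Lemma integrable_bounded h (C : R) : measurable_fun setT h ->
  (forall x, `|h x| <= C) -> m.-integrable setT (EFin \o h).
Proof.
move=> mh hC; apply: measurable_bounded_integrable => //.
exists C; split; first exact: num_real.
by move=> M CM x _; exact: le_trans (hC x) (ltW CM).
Qed.

Definition bounded_measurable h :=
  measurable_fun setT h /\ exists C, forall x, `|h x| <= C.

Lemma bounded_measurable_integrable h : bounded_measurable h ->
  m.-integrable setT (EFin \o h).
Proof. by move=> [mh [C hC]]; exact: integrable_bounded hC. Qed.

Lemma bounded_measurableB h1 h2 : bounded_measurable h1 -> bounded_measurable h2 ->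
  bounded_measurable (fun x => h1 x - h2 x).
Proof.
move=> [m1 [C1 b1]] [m2 [C2 b2]]; split; first exact: measurable_funB.
by exists (C1 + C2) => x; rewrite (le_trans (ler_normB _ _))// lerD.
Qed.

Lemma bounded_measurableM h1 h2 : bounded_measurable h1 -> bounded_measurable h2 ->
  bounded_measurable (fun x => h1 x * h2 x).
Proof.
move=> [m1 [C1 b1]] [m2 [C2 b2]]; split; first exact: measurable_funM.
by exists (C1 * C2) => x; rewrite normrM ler_pM.
Qed.

Lemma bounded_measurable_norm h : bounded_measurable h ->
  bounded_measurable (fun x => `|h x|).
Proof.
move=> [mh [C b]]; split; first exact: measurableT_comp.
by exists C => x; rewrite normr_id.
Qed.

Lemma measure_fin_num (E : set T) : measurable E -> m E \is a fin_num.
Proof.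
move=> mE; rewrite ge0_fin_numE//; apply: le_lt_trans m_fin.
by apply: le_measure; rewrite ?inE.
Qed.

(** Boundedness controls [h] on a set of small measure, smallness of [h] itself
    on the complement. *)
Lemma Rintegral_split_le h (E : set T) (a C : R) : measurable E ->
    measurable_fun setT h -> (forall x, 0 <= h x <= C) -> 0 <= a ->
    (forall x, E x -> h x <= a) ->
  \int[m]_x h x <= a * fine (m setT) + C * fine (m (~` E)).
Proof.
move=> mE mh hC a0 ha.
have mCE : measurable (~` E) by exact: measurableC.
have i1 : m.-integrable setT (EFin \o (\1_(~` E) : T -> R)).
  apply: (@integrable_bounded _ 1) => [|x]; first exact: measurable_indic.
  by rewrite indicE; case: (_ \in _); rewrite ?normr1 ?normr0.
have iC : m.-integrable setT (EFin \o (fun x => C * \1_(~` E) x)).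
  exact: (integrableZl measurableT C i1).
have ia : m.-integrable setT (EFin \o (fun _ : T => a)).
  by apply: (@integrable_bounded _ `|a|) => //; exact: measurable_cst.
rewrite (_ : fine (m (~` E)) = \int[m]_x (\1_(~` E) x)); last first.
  by rewrite /Rintegral integral_indic// setIT.
rewrite -Rintegral_cst// -RintegralZl// -RintegralD//.
apply: le_Rintegral => //.
- apply: (@integrable_bounded _ C) => // x; have /andP[h0 ?] := hC x.
  by rewrite ger0_norm.
- exact: (integrableD measurableT ia iC).
- move=> x _; rewrite indicE; have [/set_mem xE|xE] := boolP (x \in E).
    by rewrite in_setC mem_set//= mulr0 addr0 ha.
  have /andP[_ hx] := hC x.
  by rewrite in_setC xE mulr1 (le_trans hx)// lerDr.
Qed.

End finite_measure_bounds.

(** * The compactness theorem *)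

(** Rounding the coordinates to multiples of [e] leaves finitely many classes of
    indices; [r] picks one index in each class. *)
Lemma finite_net (R : realType) (I : Type) (i0 : I) (n : nat) (u : I -> 'I_n -> R)
    (C e : R) : 0 < e -> (forall i j, 0 <= u i j <= C) ->
  exists (F : finType) (r : F -> I) (c : I -> F),
    forall i j, `|u i j - u (r (c i)) j| < e.
Proof.
move=> e0 u0C; pose N := Num.truncn (C / e).
pose c i : {ffun 'I_n -> 'I_N.+1} := [ffun j => inord (Num.truncn (u i j / e))].
pose r a := if pselect (exists i, c i = a) is left h then projT1 (cid h) else i0.
have crc i : c (r (c i)) = c i.
  by rewrite /r; case: pselect => [h|[]]; [case: cid|exists i].
exists {ffun 'I_n -> 'I_N.+1}, r, c => i j.
have tr i' : Num.truncn (u i' j / e) = c i' j :> nat.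
  rewrite ffunE inordK// ltnS; apply: le_truncn.
  by rewrite ler_pM2r ?invr_gt0//; case/andP: (u0C i' j).
have itv i' : (c i' j)%:R * e <= u i' j < (c i' j).+1%:R * e.
  rewrite -tr -ler_pdivlMr// -ltr_pdivrMr//; apply: truncn_itv.
  by apply: divr_ge0; [case/andP: (u0C i' j)|exact: ltW].
have /andP[l1 r1] := itv i; have := itv (r (c i)).
rewrite crc => /andP[l2 r2]; rewrite ltr_norml; apply/andP; split;
  move: r1 r2; rewrite -natr1 mulrDl mul1r; lra.
Qed.

Section invariant_measure.
Variables (R : realType) (G : topGroupType) (H : groupClosed G).
Variable nu : {measure set (borel (right_cosets H)) -> \bar R}.
Local Notation M := (right_cosets H).
Local Notation coset := (coset H).
Hypotheses (lcG : locally_compact [set: G]) (hausdorffM : hausdorff_space M).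
Hypotheses (radon_nu : radon nu) (nu_neq0 : nu setT != 0%E) (nu_fin : (nu setT < +oo)%E).
Hypothesis nu_act : forall (x : G) (E : set (borel M)), measurable E ->
  nu ((fun X : M => coset_act X x) @^-1` E) = nu E.
Local Notation vol := (fine (nu setT)).

Lemma measurable_coset_act x :
  measurable_fun setT ((fun X : M => coset_act X x) : borel M -> borel M).
Proof. by apply: borel_continuous; exact: continuous_coset_act. Qed.

Lemma nu_open_gt0 (U : set M) : open U -> U !=set0 -> (0 < nu U)%E.
Proof.
move=> oU [Y UY]; apply: (@open_measure_gt0 _ _ nu hausdorffM radon_nu nu_neq0 G
    (fun x X => coset_act X x)) => //.
- exact: continuous_coset_act.
- by move=> x; exact: (nu_act x (borel_open oU)).
- move=> X; exists ((repr X)^-1 * repr Y)%g.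
  by rewrite -{1}(cosetK X) coset_actE mulVKg cosetK.
Qed.

(** Inner regularity of [nu] on the open set [M]. *)
Lemma inner_compact e : 0 < e ->
  exists2 E : set M, compact E & fine (nu (~` E)) < e.
Proof.
move=> e0; have [_ _ /(_ _ openT) supT] := radon_nu.
have finT : nu setT \is a fin_num by exact: measure_fin_num.
have : (nu setT - e%:E < nu setT)%E by rewrite lteBlDr// lteDl.
rewrite {2}supT => /ereal_sup_gt[_ [E [cE _] <-] ltE]; exists E => //.
have mE : measurable (E : set (borel M)).
  by apply: borel_closed; exact: compact_closed.
rewrite -lte_fin fineK; last by apply: measure_fin_num => //; exact: measurableC.
rewrite -setTD measureD// ?setTI//.
have finE : nu E \is a fin_num by exact: measure_fin_num.
by rewrite lteBlDr// addeC -lteBlDr.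
Qed.

Lemma Rintegral_continuous_gt0 (h : M -> R) X0 (C : R) : continuous h ->
  (forall X, 0 <= h X <= C) -> 0 < h X0 -> 0 < \int[nu]_X h X.
Proof.
move=> ch h0 hX0; pose c := h X0 / 2; have c0 : 0 < c by rewrite divr_gt0.
pose U := h @^-1` [set r | c < r].
have oU : open U by apply: open_comp => //; exact: open_gt.
have mU : measurable (U : set (borel M)) by exact: borel_open.
have i1 : bounded_measurable (\1_U : borel M -> R).
  split; first exact: measurable_indic.
  by exists 1 => x; rewrite indicE; case: (_ \in _); rewrite ?normr1 ?normr0.
have ih : bounded_measurable (h : borel M -> R).
  split; first exact: borel_continuous_real.
  by exists C => X; have /andP[hX hC] := h0 X; rewrite ger0_norm.
have cU : bounded_measurable (fun X : borel M => c * \1_U X).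
  apply: bounded_measurableM i1; split; first exact: measurable_cst.
  by exists c => _; rewrite gtr0_norm.
apply: (@lt_le_trans _ _ (\int[nu]_X (c * \1_U (X : borel M)))).
  rewrite RintegralZl//; last exact: bounded_measurable_integrable.
  rewrite /Rintegral integral_indic// setIT mulr_gt0// fine_gt0//.
  rewrite nu_open_gt0//=; last by exists X0; rewrite /U/= /c; lra.
  by rewrite -ge0_fin_numE// measure_fin_num.
apply: le_Rintegral => //; try exact: bounded_measurable_integrable.
move=> X _; rewrite indicE; have /andP[hX _] := h0 X.
have [/set_mem UX|] := boolP (X \in _); last by rewrite mulr0.
by rewrite mulr1 ltW.
Qed.

(** Equicontinuity reduces the values on a compact set to those at finitely many
    points, and the complement of that set has small measure. *)
Lemma equicontinuous_finite_net (I : Type) (i0 : I) (psi : I -> M -> R) (C d : R) :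
    0 < d -> (forall i, continuous (psi i)) -> (forall i X, 0 <= psi i X <= C) ->
    (forall X e, 0 < e -> \forall X' \near X, forall i, `|psi i X' - psi i X| < e) ->
  exists (F : finType) (r : F -> I), forall i, exists a,
    \int[nu]_X `|psi i X - psi (r a) X| <= d.
Proof.
move=> d0 cpsi psi0 eqc; have V0 : 0 <= vol by exact/fine_ge0/measure_ge0.
have C0 : 0 <= C by have /andP[] := psi0 i0 (coset 1%g); exact: le_trans.
(* On [E] two members of the family that agree up to [a] at the chosen points
   differ by at most [3 * a]; off [E], of measure less than [a], by at most [C]. *)
pose a := d / (3 * vol + C + 1).
have D0 : 0 < 3 * vol + C + 1 by lra.
have a0 : 0 < a by rewrite divr_gt0.
have [E cE nE] := inner_compact a0.
have mE : measurable (E : set (borel M)).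
  by apply: borel_closed; exact: compact_closed.
have [s Es] := compact_finite_nbhs cE (fun X _ => eqc X a a0).
have [F [r [c rc]]] := finite_net i0 (u := fun i (j : 'I_(size s)) =>
  psi i (nth point s j)) a0 (fun i j => psi0 i _).
exists F, r => i; exists (c i).
have bp i' : bounded_measurable (psi i' : borel M -> R).
  split; first exact: borel_continuous_real.
  by exists C => X; have /andP[? ?] := psi0 i' X; rewrite ger0_norm.
apply: (@le_trans _ _ (3 * a * vol + C * fine (nu (~` E)))).
  apply: Rintegral_split_le => //.
  - by case: (bounded_measurable_norm (bounded_measurableB (bp i) (bp (r (c i))))).
  - move=> X; rewrite normr_ge0/=.
    have /andP[? ?] := psi0 i X; have /andP[? ?] := psi0 (r (c i)) X.
    by rewrite ler_norml; apply/andP; split; lra.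
  - by rewrite mulr_ge0// ltW.
  - move=> X /Es[Z Zs ZX].
    have := rc i (Ordinal (etrans (index_mem Z s) Zs)).
    rewrite /= nth_index// => h; have := ZX i; have := ZX (r (c i)).
    move: h; rewrite !ltr_norml => /andP[? ?] /andP[? ?] /andP[? ?].
    by rewrite ler_norml; apply/andP; split; lra.
have -> : d = 3 * a * vol + C * a + a by rewrite /a; field; rewrite gt_eqF.
apply: (@le_trans _ _ (3 * a * vol + C * a)); last by rewrite lerDl ltW.
by rewrite lerD2l ler_wpM2l// ltW.
Qed.

Section kernel_operator.
Variables (f : M -> R) (B : R).
Hypothesis fH : forall x h, h \in H -> f (coset (x * h)%g) = f (coset x).
Hypotheses (cf : continuous f) (f0B : forall X, 0 <= f X <= B).
Local Notation k := (coset_kernel f).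

Definition kernel_op (xi : M -> R) (X : M) : R := \int[nu]_Y (k X Y * xi Y).

(** The [L^1] distance between the slices of the kernel at two points; it bounds
    the oscillation of [kernel_op xi] simultaneously for all bounded [xi]. *)
Definition slice_dist (X X' : M) : R := \int[nu]_Y `|k X' Y - k X Y|.

Lemma kernel_bound_ge0 : 0 <= B.
Proof. by have /andP[f0 fB] := f0B (coset 1%g); exact: le_trans fB. Qed.

Lemma bounded_kernel X : bounded_measurable (k X : borel M -> R).
Proof.
split; first by apply: borel_continuous_real; exact: continuous_kernel_r.
exists B => Y; rewrite ger0_norm /coset_kernel;
  by case/andP: (f0B (coset (repr X * (repr Y)^-1)%g)).
Qed.

Lemma bounded_continuous (xi : M -> R) C : continuous xi ->
  (forall X, 0 <= xi X <= C) -> bounded_measurable (xi : borel M -> R).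
Proof.
move=> cxi xi0; split; first exact: borel_continuous_real.
by exists C => X; have /andP[? ?] := xi0 X; rewrite ger0_norm.
Qed.

Lemma vol_ge0 : 0 <= vol.
Proof. exact/fine_ge0/measure_ge0. Qed.

(** The slices vary continuously: on a compact set carrying almost all of the
    mass this is the tube lemma, and the rest of the mass is negligible. *)
Lemma near_slice_dist X e : 0 < e -> \forall X' \near X, slice_dist X X' < e.
Proof.
move=> e0; have V0 := vol_ge0; have B0 := kernel_bound_ge0.
(* [a] bounds both the oscillation on [E] and the measure of its complement:
   [a * vol + B * a < e]. *)
pose a := e / (vol + B + 1).
have D0 : 0 < vol + B + 1 by lra.
have a0 : 0 < a by rewrite divr_gt0.
have [E cE nE] := inner_compact a0.
have mE : measurable (E : set (borel M)).
  by apply: borel_closed; exact: compact_closed.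
have := @tube_near M M R R^o k E X a cE (fun Y => cvg_kernel fH cf) a0.
apply: filterS => X' kE; apply: (@le_lt_trans _ _ (a * vol + B * fine (nu (~` E)))).
  have bk := bounded_measurable_norm
    (bounded_measurableB (bounded_kernel X') (bounded_kernel X)).
  apply: Rintegral_split_le => //; first by case: bk.
  - move=> Y; rewrite normr_ge0/=.
    have /andP[? ?] := f0B (coset (repr X * (repr Y)^-1)%g).
    have /andP[? ?] := f0B (coset (repr X' * (repr Y)^-1)%g).
    by rewrite /coset_kernel ler_norml; apply/andP; split; lra.
  - exact: ltW.
  - by move=> Y EY; exact/ltW/kE.
have -> : e = a * vol + B * a + a by rewrite /a; field; rewrite gt_eqF.
apply: (@le_lt_trans _ _ (a * vol + B * a)); last by rewrite ltrDl.
by rewrite lerD2l ler_wpM2l// ltW.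
Qed.

Section operand.
Variables (xi : M -> R) (C : R).
Hypotheses (cxi : continuous xi) (xi0C : forall X, 0 <= xi X <= C).

Lemma bounded_kernel_op X : bounded_measurable (fun Y : borel M => k X Y * xi Y).
Proof.
exact: bounded_measurableM (bounded_kernel X) (bounded_continuous cxi xi0C).
Qed.

Lemma kernel_op_dist X X' :
  `|kernel_op xi X' - kernel_op xi X| <= C * slice_dist X X'.
Proof.
have bd := bounded_measurableB (bounded_kernel X') (bounded_kernel X).
have bx := bounded_continuous cxi xi0C.
have C0 : 0 <= C by have /andP[] := xi0C X; exact: le_trans.
rewrite /kernel_op -RintegralB//;
  try (apply: bounded_measurable_integrable => //; exact: bounded_kernel_op).
under eq_Rintegral do rewrite -mulrBl.
have bp := bounded_measurableM bd bx.
apply: le_trans (le_normr_Rintegral _ (bounded_measurable_integrable nu_fin bp)) _ => //.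
rewrite /slice_dist -RintegralZl//; last first.
  by apply: bounded_measurable_integrable => //; exact: bounded_measurable_norm.
apply: le_Rintegral => //.
- by apply: bounded_measurable_integrable => //; exact: bounded_measurable_norm.
- apply: bounded_measurable_integrable => //.
  apply: bounded_measurableM; last exact: bounded_measurable_norm.
  by split; [exact: measurable_cst|exists `|C|].
- move=> Y _; rewrite normrM mulrC; apply: ler_wpM2r => //.
  by have /andP[? ?] := xi0C Y; rewrite ger0_norm.
Qed.

Lemma continuous_kernel_op : continuous (kernel_op xi).
Proof.
move=> X; have C0 : 0 <= C by have /andP[] := xi0C X; exact: le_trans.
apply/(@cvgrPdist_lt _ _ _ _ (nbhs_filter X)) => e e0.
have : 0 < e / (C + 1) by rewrite divr_gt0// ltr_wpDl.
move=> /(near_slice_dist X); apply: filterS => X'.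
rewrite ltr_pdivlMr ?ltr_wpDl// => de; rewrite distrC.
apply: le_lt_trans (kernel_op_dist X X') _; apply: le_lt_trans de.
rewrite mulrC mulrDr lerDl mulr1; exact: Rintegral_ge0.
Qed.

Lemma kernel_op_bounds X : 0 <= kernel_op xi X <= B * C * vol.
Proof.
have k0B Y : 0 <= k X Y * xi Y <= B * C.
  have /andP[? ?] := f0B (coset (repr X * (repr Y)^-1)%g).
  have /andP[? ?] := xi0C Y; rewrite mulr_ge0//=; exact: ler_pM.
apply/andP; split.
  by apply: Rintegral_ge0 => Y _; have /andP[] := k0B Y.
rewrite -Rintegral_cst//; apply: le_Rintegral => //.
- by apply: bounded_measurable_integrable => //; exact: bounded_kernel_op.
- apply: bounded_measurable_integrable => //.
  by split; [exact: measurable_cst|exists `|B * C|].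
- by move=> Y _; have /andP[] := k0B Y.
Qed.

(** Positivity propagates from [x] and [y] to [x y], where the integrand is
    positive at [Y = H y]. *)
Lemma kernel_op_gt0 x y : 0 < f (coset x) -> 0 < xi (coset y) ->
  0 < kernel_op xi (coset (x * y)%g).
Proof.
move=> fx xiy; apply: (@Rintegral_continuous_gt0 _ (coset y) (B * C)).
- move=> Y; have := @continuous_kernel_r _ _ _ _ fH (coset (x * y)%g) cf Y.
  move=> /(@cvgM R _ (nbhs Y) (nbhs_filter Y) _ _ _ _); apply; exact: cxi.
- move=> Y; have /andP[? ?] := f0B (coset (repr (coset (x * y)%g) * (repr Y)^-1)%g).
  have /andP[? ?] := xi0C Y; rewrite mulr_ge0//=; exact: ler_pM.
- by rewrite kernelE// mulgK mulr_gt0.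
Qed.

Lemma kernel_op_act x X :
  kernel_op (fun Y => xi (coset_act Y x)) X = kernel_op xi (coset_act X x).
Proof.
have [mu _] := bounded_kernel_op (coset_act X x).
rewrite /kernel_op -(Rintegral_invariant (measurable_coset_act x) (nu_act x) mu).
by apply: eq_Rintegral => Y _; rewrite kernel_act.
Qed.

End operand.

(** If [f (x y^-1) <> 0] and [xi y <> 0] with [y] in [L], then [x y^-1] is in
    [H K], and [H x] is in the image of [K L]. *)
Lemma kernel_op_support (xi : M -> R) (K L : set G) :
    (forall X, f X != 0 -> (coset @` K) X) ->
    (forall X, xi X != 0 -> (coset @` L) X) ->
  forall X, kernel_op xi X != 0 ->
    (coset @` [set (p.1 * p.2)%g | p in K `*` L]) X.
Proof.
move=> fK xiL X; apply: contraNP => nX; rewrite /kernel_op.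
rewrite (_ : (fun Y : borel M => k X Y * xi Y) = fun=> 0); last first.
  apply/funext => Y; apply/eqP; rewrite mulf_eq0; apply/orP.
  have [|xiY] := eqVneq (xi Y) 0; first by right.
  left; apply: contra_notT nX => kXY; have [y Ly yY] := xiL _ xiY.
  move: kXY; rewrite -yY -(cosetK X) kernelE// => /fK[x Kx /cosetP xy].
  exists (x * y)%g; first by exists (x, y).
  by apply/cosetP; rewrite invgM invgK in xy; rewrite -mulgA.
by rewrite Rintegral_cst// mul0r.
Qed.

(** The translates of [f2 = T (T f)] are totally bounded in the supremum norm and
    [f2] has compact support; a point outside finitely many translates of that
    support would bound [f2] by an arbitrarily small number, whereas [f2] is
    positive at [p^3]. *)
Lemma compact_of_kernel (K : set G) (p : G) : compact K ->
    (forall X, f X != 0 -> (coset @` K) X) -> 0 < f (coset p) ->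
  compact [set: M].
Proof.
move=> cK fK fp; have V0 := vol_ge0; have B0 := kernel_bound_ge0.
pose f1 := kernel_op f; pose f2 := kernel_op f1.
have cf1 : continuous f1 by exact: continuous_kernel_op f0B.
pose C1 := B * B * vol.
have f1b X : 0 <= f1 X <= C1 by exact: kernel_op_bounds.
pose q := (p * (p * p))%g.
have f2q : 0 < f2 (coset q).
  by apply: (kernel_op_gt0 cf1 f1b) => //; exact: kernel_op_gt0.
pose d := f2 (coset q) / (B + 1).
have d0 : 0 < d by rewrite divr_gt0// ltr_wpDl.
pose psi g X := f1 (coset_act X g).
have fact g : continuous (fun X => f (coset_act X g)).
  by move=> X; have := continuous_comp (@continuous_coset_act _ H g X)
    (@cf (coset_act X g)).
have cpsi g : continuous (psi g).
  by move=> X; have := continuous_comp (@continuous_coset_act _ H g X)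
    (@cf1 (coset_act X g)).
have psib g X : 0 <= psi g X <= C1 by exact: f1b.
(* The [psi g] are images of translates of [f], all with the same bound [B], so
   that [slice_dist] controls their oscillation independently of [g]. *)
have [|F [r Fr]] := equicontinuous_finite_net 1%g d0 cpsi psib.
  move=> X e e0; have : 0 < e / (B + 1) by rewrite divr_gt0// ltr_wpDl.
  move=> /(near_slice_dist X); apply: filterS => X'.
  rewrite ltr_pdivlMr ?ltr_wpDl// => de g; rewrite /psi /f1 -!(kernel_op_act cf f0B).
  apply: le_lt_trans (kernel_op_dist (fact g) _ X X') _; first by move=> ?; exact: f0B.
  by apply: le_lt_trans de; rewrite mulrC mulrDr lerDl mulr1; exact: Rintegral_ge0.
pose L := coset @` [set (p.1 * p.2)%g | p in K `*` [set (p.1 * p.2)%g | p in K `*` K]].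
have f2L X : f2 X != 0 -> L X.
  apply: kernel_op_support => // Y; exact: kernel_op_support.
have cL : compact L.
  apply: continuous_compact; last by do 2 apply: compact_mulg => //.
  by apply: continuous_subspaceT => x; exact: continuous_coset.
pose U := \big[setU/set0]_(a <- enum F) [set coset_act X (r a)^-1%g | X in L].
have cU : compact U.
  apply: bigsetU_compact => a _; apply: continuous_compact => //.
  by apply: continuous_subspaceT => X; exact: continuous_coset_act.
rewrite (_ : [set: M] = U)//; apply/seteqP; split => // X _.
apply: contrapT => nU; have fX a : f2 (coset_act X (r a)) = 0.
  apply: contrapT => /eqP /f2L LX; apply: nU; rewrite /U -bigcup_seq.
  exists a; first by rewrite /= mem_enum.
  by exists (coset_act X (r a)) => //; rewrite coset_actM mulgV coset_act1.
(* [g] carries the missed point [X] to the point where [f2] is positive. *)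
pose g := ((repr X)^-1 * q)%g; have [a ga] := Fr g.
have Xg : coset_act X g = coset q by rewrite -{1}(cosetK X) coset_actE mulVKg.
have bpsi g' : bounded_measurable (psi g' : borel M -> R).
  exact: bounded_continuous (psib g').
have : f2 (coset q) <= B * d.
  rewrite -Xg -[leLHS]subr0 -(fX a) /f2 -!(kernel_op_act cf1 f1b) /kernel_op.
  have bk g' := bounded_measurableM (bounded_kernel X) (bpsi g').
  rewrite -(RintegralB measurableT (bounded_measurable_integrable nu_fin (bk g))
    (bounded_measurable_integrable nu_fin (bk (r a)))).
  apply: le_trans (ler_wpM2l B0 ga); rewrite -RintegralZl//; last first.
    apply: bounded_measurable_integrable => //.
    by apply: bounded_measurable_norm; exact: bounded_measurableB.
  apply: le_Rintegral => //; try apply: bounded_measurable_integrable => //.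
  - exact: (bounded_measurableB (bk g) (bk (r a))).
  - apply: bounded_measurableM; first by split; [exact: measurable_cst|exists `|B|].
    by apply: bounded_measurable_norm; exact: bounded_measurableB.
  - move=> Y _; rewrite -mulrBr; have /andP[k0 kB] := f0B (coset (repr X * (repr Y)^-1)%g).
    apply: le_trans (ler_wpM2l k0 (ler_norm _)) _; exact: ler_wpM2r.
have dE : f2 (coset q) = B * d + d by rewrite /d; field; rewrite gt_eqF// ltr_wpDl.
by rewrite dE gerDl leNgt d0.
Qed.

End kernel_operator.

End invariant_measure.

(** * Haar measure and the modular function *)

Section haar_measure.
Variables (R : realType) (G : topGroupType).
Variable mu : {measure set (borel G) -> \bar R}.
Hypotheses (hausdorffG : hausdorff_space G) (lcG : locally_compact [set: G]).
Hypothesis haar_mu : right_haar mu.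

Lemma haar_open_gt0 (U : set G) : open U -> U !=set0 -> (0 < mu U)%E.
Proof.
have [radon_mu mu0 muR] := haar_mu; move=> oU [y Uy].
apply: (@open_measure_gt0 _ _ mu hausdorffG radon_mu mu0 G
    (fun x z => (z * x)%g)) => //.
- exact: continuous_mulgr.
- move=> x; have := muR x^-1%g _ (borel_open oU).
  by rewrite image_mulgr invgK.
- by move=> x; exists (x^-1 * y)%g; rewrite mulVKg.
Qed.

Lemma haar_compact_lty (K : set G) : compact K -> (mu K < +oo)%E.
Proof. by have [[+ _ _] _ _] := haar_mu; apply. Qed.

Lemma compact_borel (K : set G) : compact K -> measurable (K : set (borel G)).
Proof. by move=> cK; apply: borel_closed; exact: compact_closed. Qed.

Variable Delta : G -> R.
Hypothesis modularG : modular_function Delta.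

Lemma modular_image (x : G) (E : set (borel G)) : measurable E ->
  mu [set (x * y)%g | y in E] = ((Delta x)^-1%:E * mu E)%E.
Proof. by case: modularG => _ /(_ _ haar_mu); exact. Qed.

Lemma modular_gt0 x : 0 < Delta x. Proof. by case: modularG. Qed.

Lemma modular_preimage (x : G) (E : set (borel G)) : measurable E ->
  mu ((fun y => (x * y)%g) @^-1` E) = ((Delta x^-1%g)^-1%:E * mu E)%E.
Proof. by move=> mE; rewrite -modular_image// image_mulgl invgK. Qed.

Lemma measurable_mulgl (x : G) (E : set (borel G)) : measurable E ->
  measurable ([set (x * y)%g | y in E] : set (borel G)).
Proof.
move=> mE; rewrite image_mulgl.
have /(_ measurableT E mE) := borel_continuous (@continuous_mulgl G x^-1%g).
by rewrite setTI.
Qed.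

Lemma relatively_compact_unit_nbhs : exists2 U : set G, open U &
  (exists2 K, compact K & U `<=` K) /\ U 1%g.
Proof.
have [K nK cK] := compact_nbhs_group lcG 1%g.
exists (K^°); first exact: open_interior.
by split => //; exists K => //; exact: interior_subset.
Qed.

Lemma haar_open_finite : exists2 U : set G, open U &
  0 < fine (mu U) /\ mu U \is a fin_num.
Proof.
have [U oU [[K cK UK] U1]] := relatively_compact_unit_nbhs; exists U => //.
have Ufin : mu U \is a fin_num.
  rewrite ge0_fin_numE//; apply: le_lt_trans (haar_compact_lty cK).
  by apply: le_measure; rewrite ?inE//; [exact: borel_open|exact: compact_borel].
split => //; apply: fine_gt0; rewrite haar_open_gt0//=; last by exists 1%g.
by rewrite -ge0_fin_numE.
Qed.

(** Compare the measures of [x y U], for one [U] of positive finite measure. *)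
Lemma modularM x y : Delta (x * y)%g = Delta x * Delta y.
Proof.
have [U oU [U0 Ufin]] := haar_open_finite.
have mU := borel_open oU.
have : mu [set (x * y * z)%g | z in U] =
    mu [set (x * w)%g | w in [set (y * z)%g | z in U]].
  by rewrite image_comp; congr (mu _); apply: eq_imagel => z _; rewrite /= mulgA.
rewrite !modular_image//; last exact: measurable_mulgl.
rewrite -(fineK Ufin) -!EFinM => -[].
rewrite mulrA => /(mulIf (lt0r_neq0 U0)) /(congr1 GRing.inv).
by rewrite invfM !invrK.
Qed.

Lemma modular1 : Delta 1%g = 1.
Proof.
have D1 : Delta 1%g != 0 by rewrite gt_eqF// modular_gt0.
by apply: (mulIf D1); rewrite -modularM mulg1 mul1r.
Qed.

(** Inner regularity makes [x |-> mu (x U) = mu U / Delta x] lower semicontinuous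
    for open [U]: a compact [K] of almost full measure in [x U] stays in [y U] for
    [y] near [x]. *)
Lemma near_modular x : \forall y \near x, Delta y < 2 * Delta x.
Proof.
have [U oU [U0 Ufin]] := haar_open_finite; have mU := borel_open oU.
have [[_ _ inner] _ _] := haar_mu.
have D0 := modular_gt0 x.
have oxU : open [set (x * y)%g | y in U].
  by rewrite image_mulgl; apply: open_comp => // z _; exact: continuous_mulgl.
have : ((2 * Delta x)^-1%:E * mu U < mu [set (x * y)%g | y in U])%E.
  rewrite modular_image// -(fineK Ufin) -!EFinM lte_fin ltr_pM2r//.
  by rewrite ltf_pV2 ?posrE ?mulr_gt0// ltr_pMl// ltr1n.
rewrite (inner _ oxU) => /ereal_sup_gt[_ [K [cK KxU] <-] ltK].
have : \forall y \near x, K `<=` [set (y * z)%g | z in U].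
  move/compact_near_coveringP : (cK) => /(_ G (nbhs x)
    (fun y k => [set (y * z)%g | z in U] k) (nbhs_filter x)); apply => k /KxU.
  rewrite image_mulgl /= => Uxk.
  have c : (p.2^-1 * p.1)%g @[p --> (k, x)] --> (x^-1 * k)%g.
    apply: cvg_mulg; last exact: cvg_fst.
    by apply: cvg_invg; exact: cvg_snd.
  have : \forall p \near (k, x), U (p.2^-1 * p.1)%g.
    by apply: c; exact: open_nbhs_nbhs.
  by apply: filterS => -[k' y] /= ?; exists (y^-1 * k')%g => //; rewrite mulVKg.
apply: filterS => y Ky; have Dy := modular_gt0 y.
have : ((2 * Delta x)^-1%:E * mu U < (Delta y)^-1%:E * mu U)%E.
  rewrite -modular_image//; apply: lt_le_trans ltK _; apply: le_measure => //.
    by rewrite inE; exact: compact_borel.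
  by rewrite inE; exact: measurable_mulgl.
rewrite -(fineK Ufin) -!EFinM lte_fin ltr_pM2r//.
by rewrite ltf_pV2 ?posrE ?mulr_gt0.
Qed.

Lemma exists_bump : exists (phi : G -> R) (K : set G),
  [/\ continuous phi, forall x, 0 <= phi x <= 1, phi 1%g = 1, compact K &
      forall x, phi x != 0 -> K x].
Proof.
have [U oU [[K cK UK] U1]] := relatively_compact_unit_nbhs.
have sep := @locally_compact_completely_regular G R lcG hausdorffG 1%g (~` U).
have /uniform_separatorP : uniform_separator [set 1%g] (~` U).
  by apply: sep; [exact: open_closedC|exact].
move=> /(_ R)[f [cf f01 f0 f1]].
exists (fun x => 1 - f x), K; split => //.
- by move=> x; apply: cvgB; [exact: cvg_cst|exact: cf].
- move=> x; have : (range f) (f x) by exists x.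
  by move=> /f01; rewrite /= in_itv/= => /andP[? ?]; apply/andP; split; lra.
- by rewrite (_ : f 1%g = 0) ?subr0//; apply: f0; exists 1%g.
- move=> x; apply: contraNP => nK; rewrite (_ : f x = 1) ?subrr//.
  by apply: f1; exists x => // /UK.
Qed.

Lemma haar_bump_integral (phi : G -> R) (K : set G) : continuous phi ->
    (forall x, 0 <= phi x <= 1) -> phi 1%g = 1 -> compact K ->
    (forall x, phi x != 0 -> K x) ->
  (0 < \int[mu]_x (phi x)%:E)%E /\ (\int[mu]_x (phi x)%:E)%E \is a fin_num.
Proof.
move=> cphi phi01 phi1 cK phiK; have mK := compact_borel cK.
have mphi : measurable_fun setT (fun x : borel G => (phi x)%:E).
  by apply/measurable_EFinP; exact: borel_continuous_real.
have phi0 x : (0 <= (phi x)%:E)%E by rewrite lee_fin; case/andP: (phi01 x).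
split; last first.
  rewrite ge0_fin_numE; last exact: integral_ge0.
  apply: le_lt_trans (haar_compact_lty cK).
  rewrite -[leRHS]mul1e -integral_cst// [leRHS]integral_mkcond.
  apply: ge0_le_integral => //.
    exact: ((measurable_restrictT _ mK).1 (measurable_cst _)).
  move=> x _; rewrite patchE; case: ifPn => [_|/negP xK].
    by rewrite lee_fin; case/andP: (phi01 x).
  rewrite lee_fin le_eqVlt; apply/orP; left; apply/eqP.
  by apply: contra_notP xK => /eqP/phiK/mem_set.
pose U := phi @^-1` [set r | 2^-1 < r].
have oU : open U by apply: open_comp => //; exact: open_gt.
have mU : measurable (U : set (borel G)) by exact: borel_open.
have U1 : U 1%g by rewrite /U /= phi1 invf_lt1// ltr1n.
apply: (@lt_le_trans _ _ (\int[mu]_(x in U) (2^-1)%:E)%E).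
  by rewrite integral_cst// mule_gt0// ?lte_fin ?invr_gt0// haar_open_gt0//; exists 1%g.
rewrite integral_mkcond; apply: ge0_le_integral => //.
- by move=> x _; rewrite patchE; case: ifPn => // _; rewrite lee_fin invr_ge0.
- exact: ((measurable_restrictT _ mU).1 (measurable_cst _)).
- by move=> x _; rewrite patchE; case: ifPn => // /set_mem xU; rewrite lee_fin ltW.
Qed.

End haar_measure.

(** * Compactness and unimodularity under finite covolume *)

Section finite_covolume.
Variables (R : realType) (G : topGroupType) (H : groupClosed G).
Variable nu : {measure set (borel (right_cosets H)) -> \bar R}.
Local Notation M := (right_cosets H).
Local Notation coset := (coset H).
Hypothesis nu_fin : (nu setT < +oo)%E.
Hypothesis invariant_nu : relatively_invariant nu.

(** The whole space is invariant and has positive finite measure, so the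
    character of [nu] is trivial. *)
Lemma invariant_nu_act (x : G) (E : set (borel M)) : measurable E ->
  nu ((fun X : M => coset_act X x) @^-1` E) = nu E.
Proof.
have [_ nu0 [chi [_ _ _ nuchi]]] := invariant_nu.
move=> mE; have := nuchi x^-1%g _ mE; rewrite image_coset_act invgK => ->.
suff -> : chi x^-1%g = 1 by rewrite mul1e.
have := nuchi x^-1%g setT measurableT; rewrite image_coset_act preimage_setT.
have finT : nu setT \is a fin_num by exact: measure_fin_num.
have V0 : fine (nu setT) != 0 by rewrite fine_eq0.
rewrite -(fineK finT) -EFinM => -[] /esym/eqP.
by rewrite -[eqbRHS]mul1r (inj_eq (mulIf V0)) => /eqP.
Qed.

Lemma Cc_bounded (f : M -> R[i]^o) : Cc f -> exists B, forall X, Normc.normc (f X) <= B.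
Proof.
move=> [cf]; rewrite precompactE => cS.
have cn : {within closure [set X | f X != 0], continuous (fun X => Normc.normc (f X))}.
  apply: continuous_subspaceT => X.
  by have := continuous_comp (@cf X) (@continuous_normc R (f X)).
have /compact_bounded[B [_ hB]] := continuous_compact cn cS.
exists (`|B| + 1) => X; have [->|fX] := eqVneq (f X) 0.
  by rewrite Normc.normc0 addr_ge0.
apply: le_trans (ler_norm _) _; apply: (hB (`|B| + 1)).
  by rewrite ltr_pwDr// ler_norm.
by exists X => //; exact: subset_closure.
Qed.

Lemma hecke_Cc (f : hecke H R) : Cc f.
Proof. by case: f => f /= /heckeP[]. Qed.

Lemma hecke_invariant (f : hecke H R) x h : h \in H ->
  f (coset (x * h)%g) = f (coset x).
Proof. by case: f => f /= /heckeP[_]; exact. Qed.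

Lemma hecke_continuous (f : hecke H R) : continuous (f : M -> R[i]^o).
Proof. by case: (hecke_Cc f). Qed.

Hypotheses (lcG : locally_compact [set: G]) (hausdorffM : hausdorff_space M).

(** [compact_of_kernel] for the modulus of [f]. *)
Lemma hecke_compact (f : hecke H R) X : f X != 0 -> compact [set: M].
Proof.
have [radon_nu nu0 _] := invariant_nu.
rewrite -(cosetK X) => fX; have [B fB] := Cc_bounded (hecke_Cc f).
have cf := @hecke_continuous f.
have [_] := hecke_Cc f; rewrite precompactE => cS.
have [K cK SK] := compact_lift lcG cS.
apply: (@compact_of_kernel R G H nu hausdorffM radon_nu nu0 nu_fin
  invariant_nu_act (fun X => Normc.normc (f X)) B _ _ _ K (repr X)) => //.
- by move=> x h Hh; rewrite hecke_invariant.
- by move=> Y; have := continuous_comp (@cf Y) (@continuous_normc R (f Y)).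
- by move=> Y; rewrite normc_ge0 fB.
- move=> Y fY; apply: SK; apply: subset_closure => /=.
  by apply: contraNneq fY => ->; rewrite Normc.normc0.
- rewrite lt_neqAle normc_ge0 andbT eq_sym.
  by apply: contraNneq fX => /Normc.eq0_normc ->.
Qed.

End finite_covolume.

Section unimodularity.
Variables (R : realType) (G : topGroupType) (H : groupClosed G) (Delta : G -> R).
Variable mu : {measure set (borel G) -> \bar R}.
Variable eta : {measure set (borel (subgroup H)) -> \bar R}.
Variable nu : {measure set (borel (right_cosets H)) -> \bar R}.
Local Notation M := (right_cosets H).
Hypotheses (hausdorffG : hausdorff_space G) (lcG : locally_compact [set: G]).
Hypotheses (unimodularH : unimodular R (subgroup H)) (modularG : modular_function Delta).
Hypotheses (haar_mu : right_haar mu) (haar_eta : right_haar eta).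
Hypothesis weil : weil_formula nu mu eta.

Lemma haar_eta_left (h : subgroup H) (E : set (borel (subgroup H))) : measurable E ->
  eta ((fun k => (h * k)%g) @^-1` E) = eta E.
Proof.
case: unimodularH => _ /(_ _ haar_eta) eta1 mE.
by have := eta1 h^-1%g E mE; rewrite image_mulgl invgK invr1 mul1e.
Qed.

(** Translating a bump function on the left by [h \in H] multiplies its integral
    by a value of [Delta], but leaves every inner integral in the Weil formula
    unchanged since [H] is unimodular. *)
Lemma modular_subgroup h : h \in H -> Delta h = 1.
Proof.
move=> Hh; have [phi [K [cphi phi01 phi1 cK phiK]]] := exists_bump R hausdorffG lcG.
have [I0 Ifin] := haar_bump_integral hausdorffG haar_mu cphi phi01 phi1 cK phiK.
have real_Cc (g : G -> R) (L : set G) : continuous g -> compact L ->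
    (forall x, g x != 0 -> L x) -> Cc (fun x => (g x)%:C%C : R[i]^o).
  move=> cg cL gL; split.
    by move=> x; have := continuous_comp (@cg x) (@continuous_real_complex R (g x)).
  exists L; last by split => //; exact: compact_closed.
  by move=> x gx; apply: gL; apply: contraNneq gx => ->.
pose phih x := phi (h * x)%g.
have cphih : continuous phih.
  by move=> x; have := continuous_comp (@continuous_mulgl G h x) (@cphi (h * x)%g).
have Cphi := real_Cc _ _ cphi cK phiK.
have Cphih : Cc (fun x => (phih x)%:C%C : R[i]^o).
  apply: (real_Cc _ [set (h^-1 * y)%g | y in K]) => //.
    apply: continuous_compact cK; apply: continuous_subspaceT.
    exact: continuous_mulgl.
  by move=> x /phiK Khx; exists (h * x)%g => //; rewrite mulKg.
have : cint mu (fun x => (phih x)%:C%C) = cint mu (fun x => (phi x)%:C%C).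
  rewrite (weil Cphi) (weil Cphih); congr cint; apply/funext => Y.
  pose u (k : subgroup H) := phi (val k * repr (Y : M))%g.
  have cu : continuous u.
    move=> k; have c := @subgroup_val_continuous G H k.
    have := cvg_comp _ _ (cvg_mulg (nbhs_filter k) c (cvg_cst (repr (Y : M))))
      (@cphi (val k * repr (Y : M))%g).
    exact.
  have mu_ : cmeasurable (fun k : borel (subgroup H) => (u k)%:C%C : R[i]^o).
    apply: borel_continuous_complex => k.
    by have := continuous_comp (@cu k) (@continuous_real_complex R (u k)).
  pose hs : subgroup H := Subgroup Hh.
  have := cint_invariant (borel_continuous (@continuous_mulgl (subgroup H) hs))
    (haar_eta_left hs) mu_.
  move=> <-; congr cint; apply/funext => k.
  by rewrite /phih /u /= mulgA.
move=> /(congr1 (@complex.Re R)); rewrite /= /Rintegral /phih.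
have -> : (\int[mu]_x (phi (h * x)%g)%:E =
    (Delta h^-1%g)^-1%:E * \int[mu]_x (phi x)%:E)%E.
  apply: (@ge0_integral_scaled _ (borel G) _ mu (fun x => (h * x)%g) _ _
    (fun x : G => (phi x)%:E)).
  - exact: borel_continuous (@continuous_mulgl G h).
  - by rewrite invr_ge0 ltW// modular_gt0.
  - by move=> E mE; exact: modular_preimage.
  - by apply/measurable_EFinP; exact: borel_continuous_real.
  - by move=> x; rewrite lee_fin; case/andP: (phi01 x).
rewrite fineM//= -[RHS]mul1r => /mulIf.
have I1 : fine (\int[mu]_x (phi x)%:E)%E != 0 by rewrite fine_eq0// gt_eqF.
move=> /(_ I1) D1.
have := modularM hausdorffG lcG haar_mu modularG h h^-1%g.
rewrite mulgV (modular1 hausdorffG lcG haar_mu modularG).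
by rewrite -[Delta h^-1%g]invrK D1 invr1 mulr1 => <-.
Qed.

(** [Delta] descends to the compact quotient and is locally bounded, hence bounded;
    a bounded positive character is trivial. *)
Lemma modular_eq1 : compact [set: M] -> forall x, Delta x = 1.
Proof.
move=> cM; have DM := modularM hausdorffG lcG haar_mu modularG.
have D0 x : 0 < Delta x by exact: modular_gt0 modularG x.
have Dcoset x : Delta (repr (coset H x)) = Delta x.
  by have [h Hh ->] := repr_coset H x; rewrite DM modular_subgroup// mul1r.
have [|s Ms] := compact_finite_nbhs
    (N := fun X : M => [set Y : M | Delta (repr Y) < 2 * Delta (repr X)]) cM.
  move=> X _; rewrite -{1}(cosetK X); apply/nbhs_coset.
  apply: filterS (near_modular hausdorffG lcG haar_mu modularG (repr X)) => y.
  by rewrite /= Dcoset.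
pose S := range Delta.
have ubS : ubound S (\sum_(X <- s) 2 * Delta (repr (X : M))).
  move=> _ [x _ <-]; have [//|X Xs] := Ms (coset H x).
  rewrite /= Dcoset => /ltW /le_trans; apply.
  rewrite (big_rem X Xs) /= lerDl sumr_ge0// => Y _.
  by rewrite mulr_ge0// ltW.
(* [Delta x * sup S <= sup S], since [Delta x * Delta y] is again a value. *)
have hS : has_sup S by split; [exists (Delta 1%g), 1%g|eexists; exact: ubS].
have S0 : 0 < sup S.
  by apply: (lt_le_trans (D0 1%g)); apply: ub_le_sup; [eexists; exact: ubS|exists 1%g].
have D1 x : Delta x <= 1.
  rewrite -(ler_pM2r S0) mul1r mulrC -ler_pdivlMr//.
  apply: ge_sup; first by exists (Delta 1%g), 1%g.
  move=> _ [y _ <-]; rewrite ler_pdivlMr// -DM.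
  by apply: ub_le_sup; [eexists; exact: ubS|exists (y * x)%g].
move=> x; apply/eqP; rewrite eq_le D1/=.
have := DM x x^-1%g; rewrite mulgV (modular1 hausdorffG lcG haar_mu modularG) => ->.
by rewrite ler_piMr// ltW.
Qed.

End unimodularity.

(** * Fubini and Cauchy-Schwarz *)

Section complex_fubini.
Context d (T : measurableType d) (R : realType).
Variable m : {measure set T -> \bar R}.
Hypothesis m_fin : (m setT < +oo)%E.
Local Notation normc := (@Normc.normc R).

(** Product measures are defined for bundled finite measures. *)
Lemma finite_measureE : exists m' : {finite_measure set T -> \bar R},
  m' = m :> {measure set T -> \bar R}.
Proof.
have : fin_num_fun m by exact: lty_fin_num_fun.
case: (m) => k c h.
pose B := Measure_isFinite.Build d T R (Measure.Pack c) h.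
pose m' : {finite_measure set T -> \bar R} := HB.pack k c B.
by exists m'; destruct c.
Qed.

(** Domination by a product makes every inner integral finite, so that the real
    and imaginary parts can be exchanged without almost-everywhere provisos. *)
Lemma cint_fubini (K : T * T -> R[i]^o) (u v : T -> R) : cmeasurable K ->
    m.-integrable setT (EFin \o u) -> m.-integrable setT (EFin \o v) ->
    (forall p, normc (K p) <= u p.1 * v p.2) ->
  cint m (fun x => cint m (fun y => K (x, y))) =
  cint m (fun y => cint m (fun x => K (x, y))).
Proof.
have [m' m'E] := finite_measureE; rewrite -m'E => mK iu iv Kuv.
have mu_ : measurable_fun setT u by case/integrableP : iu => /measurable_EFinP.
have mv_ : measurable_fun setT v by case/integrableP : iv => /measurable_EFinP.
have muv : measurable_fun setT (fun p : T * T => u p.1 * v p.2).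
  by apply: measurable_funM; apply: measurableT_comp.
have iuv : (m' \x m')%E.-integrable setT (EFin \o (fun p : T * T => u p.1 * v p.2)).
  apply/integrable12ltyP; first exact/measurable_EFinP.
  rewrite [ltLHS](_ : _ = \int[m']_x (`|u x|%:E * \int[m']_y `|v y|%:E))%E; last first.
    apply: eq_integral => x _; rewrite -ge0_integralZl//; last first.
      by apply/measurable_EFinP; exact: measurableT_comp.
    by apply: eq_integral => y _; rewrite /= normrM EFinM.
  have /integrableP[_ lu] := iu; have /integrableP[_ lv] := iv.
  rewrite ge0_integralZr//; last 2 first.
  - by apply/measurable_EFinP; exact: measurableT_comp.
  - exact: integral_ge0.
  by apply: lte_mul_pinfty => //; rewrite ?integral_ge0// ge0_fin_numE ?integral_ge0.
have [iKr iKi] := cintegrable_le mK iuv Kuv.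
have i1 x : cintegrable m' (fun y => K (x, y)).
  apply: (@cintegrable_le _ _ _ _ _ (fun y => u x * v y)).
  - by case: mK => mr mi; split; [have := measurableT_comp mr (pair1_measurable x)
      |have := measurableT_comp mi (pair1_measurable x)].
  - exact: (integrableZl measurableT (u x) iv).
  - by move=> y; exact: (Kuv (x, y)).
have i2 y : cintegrable m' (fun x => K (x, y)).
  apply: (@cintegrable_le _ _ _ _ _ (fun x => u x * v y)).
  - by case: mK => mr mi; split; [have := measurableT_comp mr (pair2_measurable y)
      |have := measurableT_comp mi (pair2_measurable y)].
  - exact: (integrableZr measurableT (v y) iu).
  - by move=> x; exact: (Kuv (x, y)).
have F1 := Fubini iKr; have F2 := Fubini iKi.
rewrite /cint /=; congr Complex; rewrite /Rintegral; congr fine.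
  transitivity (\int[m']_x \int[m']_y (complex.Re (K (x, y)))%:E)%E.
    apply: eq_integral => x _; rewrite fineK//.
    by have [h _] := i1 x; exact: (integrable_fin_num measurableT h).
  rewrite F1; apply: eq_integral => y _; rewrite fineK//.
  by have [h _] := i2 y; exact: (integrable_fin_num measurableT h).
transitivity (\int[m']_x \int[m']_y (complex.Im (K (x, y)))%:E)%E.
  apply: eq_integral => x _; rewrite fineK//.
  by have [_ h] := i1 x; exact: (integrable_fin_num measurableT h).
rewrite F2; apply: eq_integral => y _; rewrite fineK//.
by have [_ h] := i2 y; exact: (integrable_fin_num measurableT h).
Qed.

(** This is the nonnegativity of the integral of [(V * u - a) ^ 2], where [V] is
    the total mass and [a] the integral of [u]. *)
Lemma Rintegral_sqr_le (u : T -> R) : 0 < fine (m setT) -> m.-integrable setT (EFin \o u) ->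
    m.-integrable setT (EFin \o (fun x => u x ^+ 2)) ->
  (\int[m]_x u x) ^+ 2 <= fine (m setT) * \int[m]_x (u x ^+ 2).
Proof.
move=> V0 iu iu2; set a := \int[m]_x u x; set b := \int[m]_x (u x ^+ 2).
have iZ (c : R) w : m.-integrable setT (EFin \o w) ->
    m.-integrable setT (EFin \o (fun x => c * w x)).
  by move=> iw; exact: (integrableZl measurableT c iw).
have ic (c : R) : m.-integrable setT (EFin \o (fun _ : T => c)).
  by apply: (@integrable_bounded _ _ _ m m_fin _ `|c|) => //; exact: measurable_cst.
set V := fine (m setT) in V0 *.
have : 0 <= \int[m]_x (V * u x - a) ^+ 2.
  by apply: Rintegral_ge0 => x _; exact: sqr_ge0.
have -> : \int[m]_x (V * u x - a) ^+ 2 =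
    \int[m]_x ((V ^+ 2 * u x ^+ 2 - (2 * V * a) * u x) + a ^+ 2).
  by apply: eq_Rintegral => x _; ring.
have i1 := iZ (V ^+ 2) _ iu2; have i2 := iZ (2 * V * a) _ iu.
rewrite RintegralD//; last exact: (integrableB measurableT i1 i2).
rewrite RintegralB// !RintegralZl// Rintegral_cst// -/a -/b -/V.
rewrite (_ : _ + _ = V * (V * b - a ^+ 2)); last by ring.
by rewrite pmulr_rge0// subr_ge0.
Qed.

End complex_fubini.

(** * Convolution and involution in the Hecke algebra *)

Section product_measurability.
Variables (R : realType) (S T : ptopologicalType) (h : S -> T -> R).
Hypotheses (cS : compact [set: S]) (cT : compact [set: T]).
Hypothesis ch : forall x y, h p.1 p.2 @[p --> (x, y)] --> h x y.

(** The Borel sets of [S * T] may exceed the product of the Borel sets, but by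
    compactness [h] is a uniform limit of functions that depend on the first
    variable only through finitely many Borel pieces. *)
Lemma measurable_joint_continuous :
  measurable_fun setT (fun p : borel S * borel T => h p.1 p.2).
Proof.
pose N (n : nat) (x : S) : set S :=
  [set x' | forall y, [set: T] y -> `|h x' y - h x y| < n.+1%:R^-1]^°.
have nN n x : nbhs x (N n x).
  apply: open_nbhs_nbhs; split; first exact: open_interior.
  by apply: (@tube_near S T R R^o h setT x _ cT (@ch x)); rewrite invr_gt0 ltr0n.
have mN n x : measurable (N n x : set (borel S)).
  by apply: borel_open; exact: open_interior.
pose step n s : borel S * borel T -> R :=
  foldr (fun x acc p => if p.1 \in N n x then h x p.2 else acc p) (fun=> 0) s.
have mstep n s : measurable_fun setT (step n s).
  elim: s => [|x s IHs] /=; first exact: measurable_cst.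
  apply: measurable_fun_ifT => //.
    apply: (measurable_fun_bool true); rewrite setTI.
    rewrite (_ : _ @^-1` _ = N n x `*` setT); first exact: measurableX.
    by apply/seteqP; split=> [[a b] /= /set_mem|[a b] [/= /mem_set]].
  have mh : measurable_fun setT (h x : borel T -> R).
    by apply: borel_continuous_real => y; exact: joint_continuous_r.
  exact: (measurableT_comp mh measurable_snd).
have near_step n s p : (exists2 x, x \in s & N n x p.1) ->
    `|h p.1 p.2 - step n s p| < n.+1%:R^-1.
  elim: s => [[]//|x s IHs] [x0 xs Nx] /=; case: ifPn => [/set_mem/interior_subset|xN].
    by apply.
  apply: IHs; exists x0 => //; move: xs; rewrite in_cons => /predU1P[x0E|//].
  by move: xN; rewrite -x0E mem_set.
have cov n := cid (compact_finite_nbhs cS (fun x _ => nN n x)).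
apply: (@measurable_fun_cvg _ _ _ _ (fun n => step n (projT1 (cov n)))) => // p _.
apply/cvgrPdist_lt => e e0; near=> n.
apply: (@lt_trans _ _ n.+1%:R^-1); last by near: n; exact: near_infty_natSinv_lt (PosNum e0).
by apply: near_step; case: (cov n) => s /= sP; exact: sP.
Unshelve. all: by end_near. Qed.

End product_measurability.

Section hecke_convolution.
Variables (R : realType) (G : topGroupType) (H : groupClosed G).
Variable nu : {measure set (borel (right_cosets H)) -> \bar R}.
Local Notation M := (right_cosets H).
Local Notation coset := (coset H).
Local Notation normc := (@Normc.normc R).
Hypotheses (lcG : locally_compact [set: G]) (hausdorffM : hausdorff_space M).
Hypotheses (nu_fin : (nu setT < +oo)%E) (invariant_nu : relatively_invariant nu).
Implicit Types (f g : hecke H R) (u v xi : borel M -> R[i]^o).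

Local Notation vol := (fine (nu setT)).

Lemma vol_gt0 : 0 < vol.
Proof.
have [_ nu0 _] := invariant_nu; apply: fine_gt0.
by rewrite nu_fin andbT lt_neqAle measure_ge0 eq_sym nu0.
Qed.

(** Membership in the Hecke algebra, measurability of the kernel and triviality
    of the modular function are all obtained from this alternative. *)
Lemma hecke_eq0_or_compact f : (forall X, f X = 0) \/ compact [set: M].
Proof.
have [f0|/existsNP[X /eqP fX]] := pselect (forall X, f X = 0); first by left.
by right; exact: (hecke_compact nu_fin invariant_nu lcG hausdorffM fX).
Qed.

Lemma Cc_eq0_or_compact (w : M -> R[i]^o) : continuous w ->
  (forall X, w X = 0) \/ compact [set: M] -> Cc w.
Proof.
move=> cw w0; split => //; case: w0 => [w0|cM].
  exists set0; last by split; [exact: compact0|exact: closed0].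
  by move=> X /=; rewrite w0 eqxx.
by exists setT => //; split => //; exact: closedT.
Qed.

Lemma hecke_bounded f : exists B, forall X Y, normc (coset_kernel f X Y) <= B.
Proof. by have [B fB] := Cc_bounded (hecke_Cc f); exists B => X Y; exact: fB. Qed.

Lemma hecke_kernel_r f X : continuous (coset_kernel f X : M -> R[i]^o).
Proof.
exact: continuous_kernel_r (@hecke_invariant _ _ _ f) _ (@hecke_continuous _ _ _ f).
Qed.

Lemma cmeasurable_kernel f X : cmeasurable (coset_kernel f X : borel M -> R[i]^o).
Proof. by apply: borel_continuous_complex; exact: hecke_kernel_r. Qed.

Lemma cintegrable_kernel f X xi : cintegrable nu xi ->
  cintegrable nu (fun Y : borel M => coset_kernel f X Y * xi Y).
Proof.
have [B fB] := hecke_bounded f; move=> ixi.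
exact: (cintegrableM (cmeasurable_kernel f X) (fB X) ixi).
Qed.

Lemma cintegrable_bounded u (C : R) : cmeasurable u -> (forall X, normc (u X) <= C) ->
  cintegrable nu u.
Proof.
move=> mu_ uC; apply: (@cintegrable_le _ _ _ _ _ (fun=> C)) => //.
by apply: (@integrable_bounded _ _ _ _ nu_fin _ `|C|) => //; exact: measurable_cst.
Qed.

Lemma cintegrable_hecke f : cintegrable nu (f : borel M -> R[i]^o).
Proof.
have [B fB] := Cc_bounded (hecke_Cc f).
apply: (cintegrable_bounded _ fB); apply: borel_continuous_complex.
exact: hecke_continuous.
Qed.

Lemma normc_hconv_le f : exists2 B : R, 0 <= B & forall xi X, cintegrable nu xi ->
  normc (hconv nu f xi X) <= B * \int[nu]_Y normc (xi Y).
Proof.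
have [B fB] := hecke_bounded f; exists (2 * B).
  by rewrite mulr_ge0// (le_trans (normc_ge0 _) (fB (coset 1%g) (coset 1%g))).
move=> xi X ixi; have inx := cintegrable_normc ixi.
rewrite -mulrA -RintegralZl//; apply: normc_cint_le.
- by apply: cmeasurableM; [exact: cmeasurable_kernel|exact: cintegrable_measurable ixi].
- exact: (integrableZl measurableT B inx).
- by move=> Y; rewrite Normc.normcM ler_wpM2r// ?normc_ge0//; exact: fB.
Qed.

(** On the compact space [M] the kernel is continuous in its first variable
    uniformly in the second, so that even for [xi] in [L^1] the convolution is
    continuous. *)
Lemma continuous_hconv f xi : cintegrable nu xi -> continuous (hconv nu f xi : M -> R[i]^o).
Proof.
move=> ixi; have [f0|cM] := hecke_eq0_or_compact f.
  rewrite (_ : hconv nu f xi = fun=> 0); last first.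
    apply/funext => X; rewrite /hconv (_ : (fun _ => _) = fun=> 0).
      by rewrite /cint !Rintegral_cst// !mul0r.
    by apply/funext => Y; rewrite f0 mul0r.
  exact: (@cst_continuous _ _ (0 : R[i]^o)).
have inx := cintegrable_normc ixi.
set I := \int[nu]_Y normc (xi Y).
have I0 : 0 <= I by apply: Rintegral_ge0 => Y _; exact: normc_ge0.
move=> X; apply/(cvg_normcP (nbhs_filter X)) => e e0.
have D0 : 0 < 2 * I + 1 by lra.
pose a := e / (2 * I + 1); have a0 : 0 < a by rewrite divr_gt0.
have := @tube_near M M R[i] R[i]^o (coset_kernel f) setT X a%:C%C cM
  (fun Y => cvg_kernel (@hecke_invariant _ _ _ f) (@hecke_continuous _ _ _ f)).
rewrite ltcR => /(_ a0); apply: filterS => X' kX.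
have -> : hconv nu f xi X - hconv nu f xi X' =
    cint nu (fun Y : borel M => (coset_kernel f X Y - coset_kernel f X' Y) * xi Y).
  rewrite /hconv -mulN1r -cintZ; last exact: cintegrable_kernel.
  rewrite -cintD; [|exact: cintegrable_kernel|]; last first.
    apply: cintegrableM (cintegrable_kernel f X' ixi); first exact: cmeasurable_cst.
    by move=> _; exact: lexx.
  by apply: eq_cint => Y; rewrite /coset_kernel mulrBl mulN1r.
apply: (@le_lt_trans _ _ (2 * (a * I))); last first.
  have -> : e = 2 * (a * I) + a by rewrite /a; field; rewrite gt_eqF.
  by rewrite ltrDl.
rewrite /I -RintegralZl//; apply: normc_cint_le.
- apply: cmeasurableM; last exact: cintegrable_measurable ixi.
  apply: (@eq_cmeasurable _ (borel M) R
    (fun Y => coset_kernel f X Y + (-1) * coset_kernel f X' Y)).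
    by move=> Y; rewrite mulN1r.
  apply: cmeasurableD; first exact: cmeasurable_kernel.
  by apply: cmeasurableM; [exact: cmeasurable_cst|exact: cmeasurable_kernel].
- exact: (integrableZl measurableT a inx).
- move=> Y; rewrite Normc.normcM ler_wpM2r// ?normc_ge0// -normcN opprB.
  have := kX Y Logic.I; set z := coset_kernel f X' Y - _.
  move=> zlt; have : (normc z)%:C%C < a%:C%C by rewrite -normr_complexE; exact: zlt.
  by rewrite ltcR => /ltW.
Qed.

(** Translate the variable of integration by [h], which fixes [u]. *)
Lemma hconv_invariant f u x h : (forall x h, h \in H -> u (coset (x * h)%g) = u (coset x)) ->
    cintegrable nu u ->
  h \in H -> hconv nu f u (coset (x * h)%g) = hconv nu f u (coset x).
Proof.
move=> uH iu Hh; rewrite -coset_actE.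
have mi : measurable_fun setT ((fun X : M => coset_act X h) : borel M -> borel M).
  by apply: borel_continuous; exact: continuous_coset_act.
have mk := cintegrable_measurable (cintegrable_kernel f (coset_act (coset x) h) iu).
rewrite /hconv -[LHS](cint_invariant mi (invariant_nu_act nu_fin invariant_nu h) mk).
apply: eq_cint => Y; rewrite (kernel_act (@hecke_invariant _ _ _ f)).
by rewrite -{2}(cosetK Y) coset_actE uH// cosetK.
Qed.

Lemma hecke_mulP f g : (hconv nu f g : M -> R[i]^o) \in @hecke_pred G H R.
Proof.
apply/heckeP; split.
  apply: Cc_eq0_or_compact; first exact: continuous_hconv (cintegrable_hecke g).
  have [f0|] := hecke_eq0_or_compact f; last by right.
  left=> X; rewrite /hconv (_ : (fun _ => _) = fun=> 0).
    by rewrite /cint !Rintegral_cst// !mul0r.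
  by apply/funext => Y; rewrite f0 mul0r.
move=> x h Hh; apply: hconv_invariant => //; last exact: cintegrable_hecke.
exact: hecke_invariant.
Qed.

Definition hecke_mul f g : hecke H R := Hecke (hecke_mulP f g).

(** The factor [Delta x] of the involution is [1] as soon as [f <> 0]
    ([modular_eq1]), so it does not occur here. *)
Lemma hecke_starP f :
  (fun X : M => (coset_kernel f (coset 1%g) X)^*%C : R[i]^o) \in @hecke_pred G H R.
Proof.
apply/heckeP; split.
  apply: Cc_eq0_or_compact.
    move=> X; have := continuous_comp (@hecke_kernel_r f (coset 1%g) X)
      (@continuous_conjc R _); exact.
  have [f0|] := hecke_eq0_or_compact f; last by right.
  by left=> X; rewrite /coset_kernel f0 conjc0.
move=> x h Hh; rewrite !(kernelE (@hecke_invariant _ _ _ f)) invgM mul1g.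
by rewrite coset_mulr ?gpredV// mul1g.
Qed.

Definition hecke_star f : hecke H R := Hecke (hecke_starP f).

Lemma hecke_starE f x : hecke_star f (coset x) = (f (coset x^-1%g))^*%C.
Proof. by rewrite /= (kernelE (@hecke_invariant _ _ _ f)) mul1g. Qed.

Lemma kernel_star f X Y : coset_kernel (hecke_star f) X Y = (coset_kernel f Y X)^*%C.
Proof. by rewrite /coset_kernel hecke_starE invgM invgK. Qed.

(** The exchange of integrals behind both multiplicativity and adjointness. *)
Lemma cint_kernel_fubini g u v : cintegrable nu u -> cintegrable nu v ->
  cint nu (fun Y : borel M => u Y * hconv nu g v Y) =
  cint nu (fun Z : borel M => cint nu (fun Y : borel M => u Y * coset_kernel g Y Z) * v Z).
Proof.
move=> iu iv; have [g0|cM] := hecke_eq0_or_compact g.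
  rewrite (_ : (fun Y => _) = fun=> 0); last first.
    apply/funext => Y; rewrite /hconv (_ : (fun _ => _) = fun=> 0).
      by rewrite /cint !Rintegral_cst// !mul0r mulr0.
    by apply/funext => Z; rewrite g0 mul0r.
  rewrite [in RHS](_ : (fun Y => _) = fun=> 0)//.
  apply/funext => Z; rewrite (_ : (fun _ => _) = fun=> 0).
    by rewrite /cint !Rintegral_cst// !mul0r.
  by apply/funext => Y; rewrite /coset_kernel g0 mulr0.
have [B gB] := hecke_bounded g.
have cg X Y := cvg_kernel (@hecke_invariant _ _ _ g) (@hecke_continuous _ _ _ g)
  (X := X) (Y := Y).
have B0 : 0 <= B by exact: le_trans (normc_ge0 _) (gB (coset 1%g) (coset 1%g)).
pose K (p : borel M * borel M) : R[i]^o := u p.1 * coset_kernel g p.1 p.2 * v p.2.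
have mg : cmeasurable (fun p : borel M * borel M => coset_kernel g p.1 p.2 : R[i]^o).
  split.
    apply: (@measurable_joint_continuous R M M
      (fun X Y => complex.Re (coset_kernel g X Y))) => // X Y.
    by have := cvg_comp _ _ (cg X Y) (@continuous_Re R (coset_kernel g X Y)).
  apply: (@measurable_joint_continuous R M M
    (fun X Y => complex.Im (coset_kernel g X Y))) => // X Y.
  by have := cvg_comp _ _ (cg X Y) (@continuous_Im R (coset_kernel g X Y)).
have mK : cmeasurable K.
  apply: cmeasurableM; first apply: cmeasurableM => //.
    have [mr mi] := cintegrable_measurable iu; split.
      exact: (measurableT_comp mr measurable_fst).
    exact: (measurableT_comp mi measurable_fst).
  have [mr mi] := cintegrable_measurable iv; split.
    exact: (measurableT_comp mr measurable_snd).
  exact: (measurableT_comp mi measurable_snd).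
have := cint_fubini nu_fin mK (integrableZl measurableT B (cintegrable_normc iu))
  (cintegrable_normc iv).
have h : forall p, normc (K p) <= B * normc (u p.1) * normc (v p.2).
  move=> p; rewrite !Normc.normcM ler_wpM2r ?normc_ge0// mulrC ler_wpM2r ?normc_ge0//.
move=> /(_ h) KE; transitivity (cint nu (fun Y => cint nu (fun Z => K (Y, Z)))).
  apply: eq_cint => Y; rewrite /hconv -cintZ; last exact: cintegrable_kernel.
  by apply: eq_cint => Z; rewrite /K /= mulrA.
rewrite KE; apply: eq_cint => Z; rewrite mulrC -cintZ.
  by apply: eq_cint => Y; rewrite /K /= mulrC.
apply: (@cintegrable_le _ _ _ _ _ (fun Y => B * normc (u Y))).
- apply: cmeasurableM; first exact: cintegrable_measurable iu.
  apply: borel_continuous_complex.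
  exact: continuous_kernel_l (@hecke_invariant _ _ _ g) _ (@hecke_continuous _ _ _ g).
- exact: (integrableZl measurableT B (cintegrable_normc iu)).
- by move=> Y; rewrite Normc.normcM mulrC ler_wpM2r ?normc_ge0.
Qed.

(** After exchanging the integrals, both sides are integrals over [Z] of the same
    inner integral, up to a translation of its variable by [z^-1]. *)
Lemma hconvA f g xi X : cintegrable nu xi ->
  hconv nu (hecke_mul f g) xi X = hconv nu f (hconv nu g xi) X.
Proof.
move=> ixi; have ikf : cintegrable nu (coset_kernel f X : borel M -> R[i]^o).
  have [B fB] := hecke_bounded f.
  exact: cintegrable_bounded (cmeasurable_kernel f X) (fB X).
rewrite {2}/hconv (cint_kernel_fubini g ikf ixi).
apply: eq_cint => Z; congr (_ * _).
pose z := repr Z.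
have mi : measurable_fun setT ((fun Y : M => coset_act Y z^-1%g) : borel M -> borel M).
  by apply: borel_continuous; exact: continuous_coset_act.
set W := coset (repr X * z^-1)%g.
have mk := cintegrable_measurable (cintegrable_kernel f W (cintegrable_hecke g)).
rewrite /= /hconv.
rewrite -[LHS](cint_invariant mi (invariant_nu_act nu_fin invariant_nu z^-1%g) mk).
apply: eq_cint => Y; congr (_ * _).
have -> : W = coset_act X z^-1%g by rewrite -{1}(cosetK X) coset_actE.
by rewrite (kernel_act (@hecke_invariant _ _ _ f)).
Qed.

Lemma hconv_lin f (a : R[i]) xi zeta X : cintegrable nu xi -> cintegrable nu zeta ->
  hconv nu f (fun Y => a * xi Y + zeta Y) X = a * hconv nu f xi X + hconv nu f zeta X.
Proof.
move=> ix iz; have ikx := cintegrable_kernel f X ix.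
rewrite /hconv -cintZ// -cintD//; last exact: cintegrable_kernel.
  by apply: eq_cint => Y; ring.
apply: cintegrableM ikx; first exact: cmeasurable_cst.
by move=> _; exact: lexx.
Qed.

Lemma hconv_linl f g (a : R[i]) xi X : cintegrable nu xi ->
  hconv nu (a *: f + g) xi X = a * hconv nu f xi X + hconv nu g xi X.
Proof.
move=> ix; have ikx := cintegrable_kernel f X ix.
rewrite /hconv -cintZ// -cintD//; last exact: cintegrable_kernel.
  apply: eq_cint => Y.
  by rewrite -[(a *: f + g : hecke H R) _]/(a * f _ + g _) mulrDl mulrA.
apply: cintegrableM ikx; first exact: cmeasurable_cst.
by move=> _; exact: lexx.
Qed.

End hecke_convolution.

(** * The left regular representation *)

Section left_regular_representation.
Variables (R : realType) (G : topGroupType) (H : groupClosed G).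
Variable nu : {measure set (borel (right_cosets H)) -> \bar R}.
Local Notation M := (right_cosets H).
Local Notation normc := (@Normc.normc R).
Hypotheses (lcG : locally_compact [set: G]) (hausdorffM : hausdorff_space M).
Hypotheses (nu_fin : (nu setT < +oo)%E) (invariant_nu : relatively_invariant nu).
Implicit Types (f g : hecke H R) (xi zeta : L2fun nu).
Local Notation vol := (fine (nu setT)).

Lemma L2fun_sqr_integrable xi :
  nu.-integrable setT (EFin \o (fun X => normc (xi X) ^+ 2)).
Proof.
case: xi => xi /= /square_integrableP[mxi lxi].
apply/integrableP; split; first exact: measurable_normc_sqr.
rewrite (eq_integral (fun X => (normc (xi X) ^+ 2)%:E))// => X _.
by rewrite /= ger0_norm// sqr_ge0.
Qed.

(** [nu] is finite, so that [L^2] is contained in [L^1]. *)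
Lemma L2fun_cintegrable xi : cintegrable nu xi.
Proof.
have mxi := L2fun_measurable xi.
have i1 : nu.-integrable setT (EFin \o (fun _ : borel M => 1 : R)).
  by apply: (@integrable_bounded _ _ _ nu nu_fin _ `|1|) => //; exact: measurable_cst.
apply: (@cintegrable_le _ _ _ nu _ (fun X => 1 + normc (xi X) ^+ 2)) => //.
  exact: (integrableD measurableT i1 (L2fun_sqr_integrable xi)).
move=> X; have := sqr_ge0 (normc (xi X) - 1); have := normc_ge0 (xi X); nra.
Qed.

Lemma hconv_L2P f xi : (hconv nu f xi : borel M -> R[i]^o) \in square_integrable_pred nu.
Proof.
apply/square_integrableP.
have mh : cmeasurable (hconv nu f xi : borel M -> R[i]^o).
  apply: borel_continuous_complex.
  by apply: continuous_hconv => //; exact: L2fun_cintegrable.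
split=> //; have [B B0 fB] := normc_hconv_le nu f.
have hB X := fB xi X (L2fun_cintegrable xi); set C := B * _ in hB.
have : nu.-integrable setT (EFin \o (fun X => normc (hconv nu f xi X) ^+ 2)).
  apply: (@integrable_bounded _ _ _ nu nu_fin _ (C ^+ 2)).
    by apply/measurable_EFinP; exact: measurable_normc_sqr.
  move=> X; rewrite ger0_norm ?sqr_ge0// lerXn2r// nnegrE ?normc_ge0//.
  exact: le_trans (normc_ge0 _) (hB X).
move=> /integrableP[_]; congr (_ < _)%E; apply: eq_integral => X _.
by rewrite /= ger0_norm// sqr_ge0.
Qed.

Definition hconv_L2 f xi : L2fun nu := MkL2fun (hconv_L2P f xi).

Definition lambda_fun f (u : L2 nu) : L2 nu := L2class (hconv_L2 f (repr u)).

(** An integral depends only on the almost-everywhere class of [xi], so the two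
    convolutions agree at every point. *)
Lemma lambda_class f xi : lambda_fun f (L2class xi) = L2class (hconv_L2 f xi).
Proof.
apply/L2class_eqP; apply: aeW => X; apply: eq_ae_cint.
- exact: cintegrable_measurable (cintegrable_kernel f X (L2fun_cintegrable _)).
- exact: cintegrable_measurable (cintegrable_kernel f X (L2fun_cintegrable xi)).
by apply: filterS (ae_repr_L2class xi) => Y ->.
Qed.

Lemma lambda_linear f : linear (lambda_fun f).
Proof.
move=> a u v; rewrite -(L2class_repr u) -(L2class_repr v).
move: (repr u) (repr v) => {u v} xi zeta.
have -> : a *: L2class xi + L2class zeta = L2class (a *: xi + zeta).
  by rewrite L2classD L2classZ.
rewrite !lambda_class; have -> : a *: L2class (hconv_L2 f xi) + L2class (hconv_L2 f zeta) =
    L2class (a *: hconv_L2 f xi + hconv_L2 f zeta) by rewrite L2classD L2classZ.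
apply/L2class_eqP; apply: aeW => X.
exact: (hconv_lin f a X (L2fun_cintegrable xi) (L2fun_cintegrable zeta)).
Qed.

HB.instance Definition _ f := GRing.isLinear.Build R[i] (L2 nu) (L2 nu) *:%R
  (lambda_fun f) (lambda_linear f).

Lemma L2norm_class xi : L2norm (L2class xi) = Num.sqrt (\int[nu]_X (normc (xi X) ^+ 2)).
Proof.
rewrite /L2norm L2dot_class /=; congr Num.sqrt; apply: eq_Rintegral => X _.
by rewrite normc_sqr; case: (xi X) => a b /=; ring.
Qed.

(** [f] is bounded and [nu] finite: the sup norm of [f * xi] is controlled by the
    [L^1] norm of [xi], hence by its [L^2] norm. *)
Lemma lambda_bounded f : exists c : R, forall u, L2norm (lambda_fun f u) <= c * L2norm u.
Proof.
have [B B0 fB] := normc_hconv_le nu f.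
have V0 := vol_gt0 nu_fin invariant_nu.
exists (B * vol) => u; rewrite -(L2class_repr u) lambda_class !L2norm_class.
move: (repr u) => {u} xi; set b := \int[nu]_X (normc (xi X) ^+ 2).
have b0 : 0 <= b by apply: Rintegral_ge0 => X _; exact: sqr_ge0.
have ix := L2fun_cintegrable xi.
have := Rintegral_sqr_le nu_fin V0 (cintegrable_normc ix) (L2fun_sqr_integrable xi).
rewrite -/b; set a := \int[nu]_X normc (xi X) => ab.
have a0 : 0 <= a by apply: Rintegral_ge0 => X _; exact: normc_ge0.
have C0 : 0 <= B * vol by rewrite mulr_ge0// ltW.
rewrite -[X in X * Num.sqrt b]ger0_norm// -sqrtr_sqr -sqrtrM ?sqr_ge0//.
rewrite ler_wsqrtr//; apply: (@le_trans _ _ ((B * a) ^+ 2 * vol)).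
  rewrite -Rintegral_cst//; apply: le_Rintegral => //.
  - exact: L2fun_sqr_integrable (hconv_L2 f xi).
  - apply: (@integrable_bounded _ _ _ nu nu_fin _ `|(B * a) ^+ 2|) => //;
      exact: measurable_cst.
  - by move=> X _; rewrite lerXn2r// ?nnegrE ?normc_ge0 ?mulr_ge0//; exact: fB.
have -> : (B * a) ^+ 2 * vol = B ^+ 2 * vol * a ^+ 2 by ring.
have -> : (B * vol) ^+ 2 * b = B ^+ 2 * vol * (vol * b) by ring.
by rewrite ler_wpM2l// mulr_ge0// ?sqr_ge0// ltW.
Qed.

Definition lambda f : bounded_operator nu :=
  BoundedOperator (operator := lambda_fun f) (lambda_bounded f).

Lemma lambdaM f g u :
  lambda (hecke_mul lcG hausdorffM nu_fin invariant_nu f g) u = lambda f (lambda g u).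
Proof.
rewrite -(L2class_repr u) /= (lambda_class g) !lambda_class; apply/L2class_eqP; apply: aeW => X.
by have := hconvA lcG hausdorffM nu_fin invariant_nu f g X (L2fun_cintegrable (repr u)).
Qed.

Lemma lambda_linl (a : R[i]) f g u : lambda (a *: f + g) u = a *: lambda f u + lambda g u.
Proof.
rewrite -(L2class_repr u) /= !lambda_class.
have -> : a *: L2class (hconv_L2 f (repr u)) + L2class (hconv_L2 g (repr u)) =
    L2class (a *: hconv_L2 f (repr u) + hconv_L2 g (repr u)).
  by rewrite L2classD L2classZ.
apply/L2class_eqP; apply: aeW => X.
by have := hconv_linl f g a X (L2fun_cintegrable (repr u)).
Qed.

(** The kernel of [f^*] is the conjugate transpose of the kernel of [f]. *)
Lemma lambda_adjoint f :
  adjoint_operator (lambda f) (lambda (hecke_star lcG hausdorffM nu_fin invariant_nu f)).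
Proof.
move=> u v; rewrite -(L2class_repr u) -(L2class_repr v) /= !lambda_class !L2dot_class.
move: (repr u) (repr v) => {u v} xi zeta /=.
have ix := L2fun_cintegrable xi; have iz := L2fun_cintegrable zeta.
have izc : cintegrable nu (fun X => (zeta X)^*%C).
  apply: (cintegrable_le _ (cintegrable_normc iz)).
    by apply: cmeasurable_conj; exact: L2fun_measurable.
  by move=> X; rewrite normc_conj.
transitivity (cint nu (fun X : borel M => (zeta X)^*%C * hconv nu f xi X)).
  by apply: eq_cint => X; rewrite mulrC.
rewrite (cint_kernel_fubini lcG hausdorffM nu_fin invariant_nu f izc ix).
apply: eq_cint => Y; rewrite mulrC; congr (_ * _).
transitivity (cint nu (fun X : borel M => coset_kernel (hecke_star lcG hausdorffM
    nu_fin invariant_nu f) Y X * zeta X))^*%C; last by [].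
rewrite -cint_conj; last exact: cintegrable_kernel.
by apply: eq_cint => X; rewrite kernel_star rmorphM /= conjcK mulrC.
Qed.

End left_regular_representation.

Theorem theorem6p1 (R : realType) (G : topGroupType) (H : groupClosed G)
    (Delta : G -> R)
    (mu : {measure set (borel G) -> \bar R})
    (eta : {measure set (borel (subgroup H)) -> \bar R})
    (nu : {measure set (borel (right_cosets H)) -> \bar R})
    (hausdorffG : hausdorff_space G)
    (locally_compactG : locally_compact [set: G])
    (closedH : closed [set x : G | x \in H])
    (unimodularH : unimodular R (subgroup H))
    (modularG : modular_function Delta)
    (haar_mu : right_haar mu)
    (haar_eta : right_haar eta)
    (invariant_nu : relatively_invariant nu)
    (finite_nu : (nu setT < +oo)%E)
    (normalized_nu : weil_formula nu mu eta) :
  exists (mul : hecke H R -> hecke H R -> hecke H R)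
         (star : hecke H R -> hecke H R)
         (lambda : hecke H R -> bounded_operator nu),
    (forall f g : hecke H R, mul f g =1 hconv nu f g) /\
    (forall (f : hecke H R) (x : G),
      star f (coset H x) = (Delta x)%:C%C * (f (coset H x^-1%g))^*%C) /\
    (forall (f : hecke H R) (xi : L2fun nu),
      (forall X : right_cosets H, cintegrable nu
        (fun Y : borel (right_cosets H) =>
          f (coset H (repr X * (repr (Y : right_cosets H))^-1)%g) * xi Y)) /\
      exists2 zeta : L2fun nu,
        zeta =1 hconv nu f xi & lambda f (L2class xi) = L2class zeta) /\
    [/\ forall (a : R[i]) (f g : hecke H R) (u : L2 nu),
          lambda (a *: f + g) u = a *: lambda f u + lambda g u,
        forall (f g : hecke H R) (u : L2 nu),
          lambda (mul f g) u = lambda f (lambda g u)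
      & forall f : hecke H R, adjoint_operator (lambda f) (lambda (star f))].
Proof.
have hausdorffM := hausdorff_cosets closedH.
exists (hecke_mul locally_compactG hausdorffM finite_nu invariant_nu),
  (hecke_star locally_compactG hausdorffM finite_nu invariant_nu),
  (lambda locally_compactG hausdorffM finite_nu invariant_nu).
split=> [//|]; split=> [f x|].
  rewrite hecke_starE.
  have [f0|cM] := hecke_eq0_or_compact locally_compactG hausdorffM finite_nu invariant_nu f.
    by rewrite f0 conjc0 mulr0.
  by rewrite (modular_eq1 hausdorffG locally_compactG unimodularH modularG haar_mu
    haar_eta normalized_nu cM) mul1r.
split=> [f xi|].
  split=> [X|]; first exact: (cintegrable_kernel f X (L2fun_cintegrable finite_nu xi)).
  by exists (hconv_L2 locally_compactG hausdorffM finite_nu invariant_nu f xi);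
    rewrite //= lambda_class.
split; [exact: lambda_linl|exact: lambdaM|exact: lambda_adjoint].
Qed.
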